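(* Let $X$ be a smooth projective variety over an algebraically closed field $\mathbb{K}$ of characteristic zero such that $H^i(X,\mathcal{O}_X)=0$ for $i=1,2$, and let $\mathcal{E}$ be a locally free sheaf of $\mathcal{O}_X$-modules on $X$ with $h^0(X,\mathcal{E})\ge k$. If there exists $U\in Gr(k,H^0(X,\mathcal{E}))$ such that $\mathrm{Hom}(U,H^1(X,\mathcal{E}))=0$ or, in an equivalent way, such that the map $\alpha:H^1(X,\mathcal{E}nd(\mathcal{E}))\to\mathrm{Hom}(U,H^1(X,\mathcal{E}))$ is surjective, then $$\mathrm{Def}_{\mathcal{E}}\text{ is smooth}\ \Longleftrightarrow\ \mathrm{Def}_{(\mathcal{E},U)}\text{ is smooth}\ \Longleftrightarrow\ \mathrm{Def}^k_{\mathcal{E}}\text{ is smooth}.$$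
   Context: $\mathbf{Art}_{\mathbb{K}}$ is the category of local Artinian $\mathbb{K}$-algebras with residue field $\mathbb{K}$. A functor $F:\mathbf{Art}_{\mathbb{K}}\to\mathbf{Sets}$ is smooth if $F(B)\to F(A)$ is surjective for every surjection $B\to A$ in $\mathbf{Art}_{\mathbb{K}}$. $\alpha$ is the map $a\mapsto(s\mapsto a\cup s)$, the cup product being induced by evaluation $\mathcal{E}nd(\mathcal{E})\otimes\mathcal{E}\to\mathcal{E}$, with $\mathcal{E}nd(\mathcal{E})$ the sheaf of $\mathcal{O}_X$-linear endomorphisms. A deformation of $\mathcal{E}$ over $A\in\mathbf{Art}_{\mathbb{K}}$ is a locally free sheaf $\mathcal{E}_A$ of $\mathcal{O}_X\otimes A$-modules on $X\times\mathrm{Spec}\,A$ with a morphism $\pi_A:\mathcal{E}_A\to\mathcal{E}$ inducing $\mathcal{E}_A\otimes_A\mathbb{K}\cong\mathcal{E}$; isomorphisms commute with the maps to $\mathcal{E}$. For $U\subseteq H^0(X,\mathcal{E})$, a deformation of $(\mathcal{E},U)$ over $A$ is $(\mathcal{E}_A,\pi_A,i_A)$ with $(\mathcal{E}_A,\pi_A)$ a deformation of $\mathcal{E}$ and $i_A:U\otimes A\to H^0(X\times\mathrm{Spec}\,A,\mathcal{E}_A)$ a morphism (of $A$-modules) with $\pi_A\circ i_A=i\circ\pi$, where $\pi:U\otimes A\to U$ is the reduction and $i:U\hookrightarrow H^0(X,\mathcal{E})$ the inclusion. Two such are isomorphic if there are an isomorphism $\phi:\mathcal{E}_A\to\mathcal{E}'_A$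 with $\pi'_A\phi=\pi_A$ and an isomorphism $\psi:U\otimes A\to U\otimes A$ with $\phi\circ i_A=i'_A\circ\psi$. $\mathrm{Def}_{\mathcal{E}}$, $\mathrm{Def}_{(\mathcal{E},U)}$ are the functors of isomorphism classes and $r_U:\mathrm{Def}_{(\mathcal{E},U)}\to\mathrm{Def}_{\mathcal{E}}$ forgets $i_A$. $Gr(k,H^0(X,\mathcal{E}))$ is the Grassmannian of $k$-dimensional subspaces. $\mathrm{Def}^k_{\mathcal{E}}(A)=\bigcup_{U\in Gr(k,H^0(X,\mathcal{E}))}r_U(\mathrm{Def}_{(\mathcal{E},U)}(A))$.
   Formalization: The hypothesis is only Hom(U,H^1(X,E))=0; surjectivity of α is derived as a conclusion, not allowed as an equivalent hypothesis, because the claimed equivalence is false and the proposition fails for α merely surjective (P^1×P^1, E=O⊕O(-2,0)⊕O(0,2), U=K·1). *)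

(* Defs.v *)
From HB Require Import structures.
From mathcomp Require Import all_boot all_order all_algebra.
From mathcomp Require Import boolp classical_sets functions.
From mathcomp Require Import mpoly.

Set Implicit Arguments.
Unset Strict Implicit.
Unset Printing Implicit Defensive.

Import GRing.Theory.
Local Open Scope classical_set_scope.
Local Open Scope ring_scope.
Local Open Scope quotient_scope.

(* A point of P^n is given by its homogeneous coordinates, normalised so that
   the first nonzero one is 1. *)
Record pspace (K : fieldType) (n : nat) := PPoint {
  hcoord : 'I_n.+1 -> K;
  _ : exists2 i, hcoord i = 1 & forall j : 'I_n.+1, (j < i)%N -> hcoord j = 0
}.

Section PolynomialValues.
Variables (K : fieldType) (n : nat).

Definition pval (A : comAlgType K) (P : {mpoly A[n.+1]}) (x : pspace K n) : A :=
  P.@[fun i => (hcoord x i)%:A].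

Definition kval (F : {mpoly K[n.+1]}) (x : pspace K n) : K := F.@[hcoord x].

Lemma pval_map (A B : comAlgType K) (f : {lrmorphism A -> B})
  (P : {mpoly A[n.+1]}) x : pval (map_mpoly f P) x = f (pval P x).
Proof.
elim/mpolyind: P => [|c m P _ _ IH]; first by rewrite /pval !rmorph0.
rewrite /pval in IH *; rewrite rmorphD mevalD IH mevalD rmorphD; congr (_ + _).
rewrite [X in X.@[_] ]map_mpolyZ map_mpolyX !mevalZ !mevalX rmorphM rmorph_prod.
congr (_ * _); apply: eq_bigr => i _.
by rewrite rmorphXn /= linearZ /= rmorph1.
Qed.

Lemma pval_const (A : comAlgType K) (F : {mpoly K[n.+1]}) x :
  pval (map_mpoly (in_alg A) F) x = (kval F x)%:A.
Proof.
elim/mpolyind: F => [|c m F _ _ IH].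
  by rewrite /pval /kval !rmorph0 scale0r.
rewrite /pval /kval in IH *; rewrite rmorphD !mevalD IH scalerDl; congr (_ + _).
rewrite [X in X.@[_] ]map_mpolyZ map_mpolyX !mevalZ !mevalX /= mulr_algl -scalerA; congr (_ *: _).
have -> a : a%:A = in_alg A a by [].
rewrite rmorph_prod; apply: eq_bigr => i _.
by rewrite rmorphXn.
Qed.

Lemma dhomog_map (R S : nzRingType) (f : {rmorphism R -> S}) d
  (P : {mpoly R[n.+1]}) : P \is d.-homog -> map_mpoly f P \is d.-homog.
Proof.
move=> /dhomogP hP; apply/dhomogP => m mP; apply: hP.
apply: contraTT mP; rewrite !mcoeff_msupp !negbK mcoeff_map_mpoly => /eqP ->.
by rewrite raddf0.
Qed.

End PolynomialValues.

Section ZariskiTopology.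
Variables (K : fieldType) (n : nat).

Definition zero_locus (S : set {mpoly K[n.+1]}) : set (pspace K n) :=
  [set x | forall F, S F -> kval F x = 0].

Definition homog_set (S : set {mpoly K[n.+1]}) : Prop :=
  forall F, S F -> exists d, F \is d.-homog.

Definition zclosed (Z : set (pspace K n)) : Prop :=
  exists2 S, homog_set S & Z = zero_locus S.

Definition zirreducible (Z : set (pspace K n)) : Prop :=
  Z !=set0 /\ forall Y1 Y2, zclosed Y1 -> zclosed Y2 ->
    Z `<=` Y1 `|` Y2 -> Z `<=` Y1 \/ Z `<=` Y2.

Definition has_chain (Z : set (pspace K n)) (m : nat) : Prop :=
  exists Y : nat -> set (pspace K n),
    (forall i, (i <= m)%N -> [/\ zclosed (Y i), zirreducible (Y i) & Y i `<=` Z]) /\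
    (forall i, (i < m)%N -> Y i `<` Y i.+1).

Definition krull_dim (Z : set (pspace K n)) (d : nat) : Prop :=
  has_chain Z d /\ ~ has_chain Z d.+1.

(* Tangent space at x of the affine cone over Z: the kernel of the Jacobian
   matrix of the homogeneous ideal of Z. *)
Definition cone_tangent (Z : set (pspace K n)) (x : pspace K n) : set 'rV[K]_n.+1 :=
  [set v | forall (d : nat) (F : {mpoly K[n.+1]}), F \is d.-homog ->
    (forall y, Z y -> kval F y = 0) -> \sum_i kval F^`M(i) x * v 0 i = 0].

(* Jacobian criterion: the tangent space of the cone has dimension dim Z + 1. *)
Definition zsmooth (Z : set (pspace K n)) : Prop :=
  exists2 d, krull_dim Z d & forall x, Z x ->
    exists2 T : {vspace 'rV[K]_n.+1},
      \dim T = d.+1 & cone_tangent Z x = [set v | v \in T].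

Definition smooth_projective_variety (X : set (pspace K n)) : Prop :=
  [/\ zclosed X, zirreducible X & zsmooth X].

End ZariskiTopology.

Section Opens.
Variables (K : fieldType) (n : nat) (X : set (pspace K n)).

Definition zopen (V : set X) : Prop :=
  exists2 S : set {mpoly K[n.+1]}, homog_set S &
    V = [set x : X | ~ zero_locus S (\val x)].

Record opens := Opens { oset :> set X; osetP : zopen oset }.

Lemma zopenP (V : set X) : zopen V <-> forall x, V x ->
  exists F d, [/\ F \is d.-homog, kval F (\val x) != 0 &
    forall y : X, kval F (\val y) != 0 -> V y].
Proof.
split=> [[S hS ->] x /= /existsNP[F /not_implyP[SF /eqP Fx]]|H].
  have [d hF] := hS _ SF; exists F, d; split=> // y /eqP Fy yS.
  exact: Fy (yS _ SF).
exists [set F | (exists d, F \is d.-homog) /\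
    forall y : X, kval F (\val y) != 0 -> V y]; first by move=> F [].
apply/seteqP; split=> x /=.
  move=> /H [F [d [hF Fx FV]]] /(_ F) xF; move/eqP: Fx; apply.
  by apply: xF; split=> //; exists d.
by move=> /existsNP[F /not_implyP[[_ FV] /eqP]]; apply: FV.
Qed.

Lemma zopenT : zopen [set: X].
Proof.
apply/zopenP => x _; exists 1, 0%N; split=> //; first exact: dhomog1.
by rewrite /kval rmorph1 oner_neq0.
Qed.

Lemma zopenI (V W : set X) : zopen V -> zopen W -> zopen (V `&` W).
Proof.
move=> /zopenP oV /zopenP oW; apply/zopenP => x [Vx Wx].
have [F [d [hF Fx FV]]] := oV x Vx; have [G [e [hG Gx GW]]] := oW x Wx.
exists (F * G), (d + e)%N; split; first exact: dhomogM.
  by rewrite /kval rmorphM mulf_neq0.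
by move=> y; rewrite /kval rmorphM mulf_eq0 negb_or => /andP[/FV ? /GW ?]; split.
Qed.

Lemma zopen_bigI p (V : 'I_p -> opens) : zopen [set x | forall j, oset (V j) x].
Proof.
elim: p V => [|p IHp] V.
  by rewrite (_ : [set x | _] = setT); [exact: zopenT|apply/seteqP; split=> // x _ []].
rewrite (_ : [set x | _] =
    oset (V ord0) `&` [set x | forall j, oset (V (lift ord0 j)) x]).
  by apply: zopenI; [exact: osetP|exact: (IHp (fun j => V (lift ord0 j)))].
apply/seteqP; split=> x /=; first by move=> Vx; split.
by move=> [V0 Vl] j; have [i ->|->] := unliftP ord0 j.
Qed.

Definition oall : opens := Opens zopenT.
Definition ocap (V W : opens) : opens := Opens (zopenI (osetP V) (osetP W)).
Definition obigcap p (V : 'I_p -> opens) : opens := Opens (zopen_bigI V).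

End Opens.
Arguments oall {K n} X.


Section Regular.
Variables (K : fieldType) (n : nat) (X : set (pspace K n)).

(* Sections over V of O_X (x)_K A, as A-valued functions that are locally
   quotients P / Q of homogeneous polynomials of the same degree, P with
   coefficients in A and Q with coefficients in K. As X is reduced, a section
   is determined by its values. *)
Definition is_regular (A : comAlgType K) (V : opens X) (f : V -> A) : Prop :=
  forall x : X, oset V x -> exists (W : opens X) (d : nat)
      (P : {mpoly A[n.+1]}) (Q : {mpoly K[n.+1]}),
    [/\ oset W x, P \is d.-homog, Q \is d.-homog &
      forall y : V, oset W (\val y) -> kval Q (\val (\val y)) != 0 /\
        f y = (kval Q (\val (\val y)))^-1 *: pval P (\val (\val y))].

Section RegularRing.
Variables (A : comAlgType K) (V : opens X).

Definition regular_pred : {pred (V -> A)} := fun f => `[< is_regular f >].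

Record reg := Reg { regfun :> V -> A; _ : regfun \in regular_pred }.
HB.instance Definition _ := [isSub for regfun].
HB.instance Definition _ := [Choice of reg by <:].

Lemma regular_cst (a : A) : is_regular (fun _ : V => a).
Proof.
move=> x Vx; exists (oall X), 0%N, a%:MP, 1; split=> //.
- by rewrite -[a%:MP]mulr1 mul_mpolyC; apply: rpredZ; exact: dhomog1.
- exact: dhomog1.
- by move=> y _; rewrite /kval /pval rmorph1 mevalC invr1 scale1r oner_neq0.
Qed.

Lemma regular_subring : subring_closed regular_pred.
Proof.
split.
- by apply/asboolP; apply: (regular_cst 1).
- move=> f g /asboolP fr /asboolP gr; apply/asboolP => x Vx.
  have [W1 [d1 [P1 [Q1 [W1x hP1 hQ1 fE]]]]] := fr x Vx.
  have [W2 [d2 [P2 [Q2 [W2x hP2 hQ2 gE]]]]] := gr x Vx.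
  exists (ocap W1 W2), (d1 + d2)%N,
    (P1 * map_mpoly (in_alg A) Q2 - P2 * map_mpoly (in_alg A) Q1), (Q1 * Q2).
  split=> //.
  + apply: rpredB; first by apply: dhomogM => //; exact: dhomog_map.
    by rewrite addnC; apply: dhomogM => //; exact: dhomog_map.
  + exact: dhomogM.
  + move=> y [/fE[n1 f1] /gE[n2 g1]].
    rewrite -[(f - g) y]/(f y - g y) f1 g1; move: n1 n2 => {f1 g1}.
    set z := \val (\val y).
    rewrite /pval mevalB !mevalM -!/(pval _ _) !pval_const.
    have -> : kval (Q1 * Q2) z = kval Q1 z * kval Q2 z by rewrite /kval mevalM.
    move=> n1 n2; split; first by rewrite mulf_neq0.
    rewrite !mulr_algr scalerBr !scalerA; congr (_ *: _ - _ *: _); rewrite invfM.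
      by rewrite mulfVK.
    by rewrite mulrAC mulVf ?mul1r.
- move=> f g /asboolP fr /asboolP gr; apply/asboolP => x Vx.
  have [W1 [d1 [P1 [Q1 [W1x hP1 hQ1 fE]]]]] := fr x Vx.
  have [W2 [d2 [P2 [Q2 [W2x hP2 hQ2 gE]]]]] := gr x Vx.
  exists (ocap W1 W2), (d1 + d2)%N, (P1 * P2), (Q1 * Q2).
  split=> //; try exact: dhomogM.
  move=> y [/fE[n1 f1] /gE[n2 g1]]; rewrite /kval /pval !mevalM mulf_neq0 //.
  split=> //; rewrite -/(kval _ _) -/(pval _ _).
  by rewrite -[(f * g) y]/(f y * g y) f1 g1 -scalerAl -scalerAr scalerA invfM.
Qed.
HB.instance Definition _ :=
  GRing.isSubringClosed.Build (V -> A) regular_pred regular_subring.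
HB.instance Definition _ :=
  GRing.SubChoice_isSubComPzRing.Build (V -> A) regular_pred reg regular_subring.

Definition regc (a : A) : reg := Reg (introT (asboolP _) (regular_cst a)).

Lemma regc_is_zmod_morphism : zmod_morphism regc.
Proof. by move=> a b; apply: val_inj. Qed.
Lemma regc_is_monoid_morphism : monoid_morphism regc.
Proof. by split=> [|a b]; apply: val_inj. Qed.
HB.instance Definition _ :=
  GRing.isZmodMorphism.Build A reg regc regc_is_zmod_morphism.
HB.instance Definition _ :=
  GRing.isMonoidMorphism.Build A reg regc regc_is_monoid_morphism.

End RegularRing.

Arguments regular_pred A V : clear implicits.
Arguments reg A V : clear implicits.

Definition incl (V W : opens X) (h : W `<=` V) (y : W) : V :=
  exist _ (\val y) (mem_set (h _ (set_valP y))).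

Section Restriction.
Variables (A : comAlgType K) (V W : opens X) (h : W `<=` V).

Lemma regular_res (r : reg A V) : (r \o incl h) \in regular_pred A W.
Proof.
apply/asboolP => x Wx; have /asboolP/(_ x (h Wx)) := valP r.
move=> [Z [d [P [Q [Zx hP hQ rE]]]]]; exists Z, d, P, Q; split=> // y Zy.
exact: (rE (incl h y)).
Qed.

Definition rres (r : reg A V) : reg A W := Reg (regular_res r).

Lemma rres_is_zmod_morphism : zmod_morphism rres.
Proof. by move=> a b; apply: val_inj. Qed.
Lemma rres_is_monoid_morphism : monoid_morphism rres.
Proof. by split=> [|a b]; apply: val_inj. Qed.
HB.instance Definition _ :=
  GRing.isZmodMorphism.Build (reg A V) (reg A W) rres rres_is_zmod_morphism.
HB.instance Definition _ :=
  GRing.isMonoidMorphism.Build (reg A V) (reg A W) rres rres_is_monoid_morphism.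

End Restriction.

Section CoefficientChange.
Variables (A B : comAlgType K) (f : {lrmorphism A -> B}) (V : opens X).

Lemma regular_comp (r : reg A V) : (f \o r) \in regular_pred B V.
Proof.
apply/asboolP => x Vx; have /asboolP/(_ x Vx) := valP r.
move=> [Z [d [P [Q [Zx hP hQ rE]]]]]; exists Z, d, (map_mpoly f P), Q.
split=> //; first exact: dhomog_map.
by move=> y /rE[Qy ry]; split=> //; rewrite pval_map -linearZ -ry.
Qed.

Definition rmap (r : reg A V) : reg B V := Reg (regular_comp r).

End CoefficientChange.
End Regular.


Section Modules.
Variables (K : fieldType) (n : nat) (X : set (pspace K n)).

Record pmod (A : comAlgType K) := PMod {
  psec : forall V : opens X, lmodType (reg A V);
  pres : forall V W : opens X, W `<=` V -> psec V -> psec W;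
  pres_linear : forall (V W : opens X) (h : W `<=` V) r s t,
    pres h (r *: s + t) = rres h r *: pres h s + pres h t;
  pres_id : forall (V : opens X) (h : V `<=` V) s, pres h s = s;
  pres_comp : forall (V W Z : opens X) (h : W `<=` V) (h' : Z `<=` W) (h'' : Z `<=` V) s,
    pres h' (pres h s) = pres h'' s
}.

Definition gsec (A : comAlgType K) (F : pmod A) := psec F (oall X).

Definition is_sheaf (A : comAlgType K) (F : pmod A) : Prop :=
  forall (V : opens X) (I : Type) (W : I -> opens X) (h : forall i, W i `<=` V),
    (forall x, oset V x -> exists i, oset (W i) x) ->
  forall s : forall i, psec F (W i),
    (forall i j (hi : ocap (W i) (W j) `<=` W i) (hj : ocap (W i) (W j) `<=` W j),
       pres hi (s i) = pres hj (s j)) ->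
  exists! t : psec F V, forall i, pres (h i) t = s i.

(* The morphism from the free module of rank m to F given by e is an
   isomorphism over V. *)
Definition is_frame (A : comAlgType K) (F : pmod A) (V : opens X) (m : nat)
    (e : 'I_m -> psec F V) : Prop :=
  forall (W : opens X) (h : W `<=` V) (s : psec F W),
    exists! r : 'I_m -> reg A W, s = \sum_i r i *: pres h (e i).

Definition locally_free (A : comAlgType K) (F : pmod A) : Prop :=
  forall x : X, exists (V : opens X) (m : nat) (e : 'I_m -> psec F V),
    oset V x /\ is_frame e.

(* Morphisms of presheaves that are semilinear along O_X (x) A -> O_X (x) B. *)
Record smor (A B : comAlgType K) (f : {lrmorphism A -> B})
    (E : pmod A) (F : pmod B) := SMor {
  smap :> forall V : opens X, psec E V -> psec F V;
  smap_linear : forall V r s t,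
    @smap V (r *: s + t) = rmap f r *: smap s + smap t;
  smap_res : forall (V W : opens X) (h : W `<=` V) s,
    @smap W (pres h s) = pres h (@smap V s)
}.

Definition mor (A : comAlgType K) (E F : pmod A) := smor idfun E F.

Definition mor_iso (A : comAlgType K) (E F : pmod A) (phi : mor E F) : Prop :=
  forall V, bijective (phi V).

(* p induces an isomorphism between F and the sheaf E (x)_A B, that is, p is
   universal among the semilinear morphisms from E to a sheaf of
   (O_X (x) B)-modules. *)
Definition is_base_change (A B : comAlgType K) (f : {lrmorphism A -> B})
    (E : pmod A) (F : pmod B) (p : smor f E F) : Prop :=
  forall (G : pmod B), is_sheaf G -> forall q : smor f E G,
  exists2 u : mor F G, (forall V s, u V (p V s) = q V s) &
    forall u' : mor F G, (forall V s, u' V (p V s) = q V s) ->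
      forall V s, u' V s = u V s.

Section StructureSheaf.
Variable A : comAlgType K.

Lemma struct_linear (V W : opens X) (h : W `<=` V) (r : reg A V)
  (s t : (reg A V)^o) : rres h (r *: s + t) = rres h r *: (rres h s : (reg A W)^o) + rres h t.
Proof. by rewrite rmorphD; congr (_ + _); exact: rmorphM. Qed.

Lemma rres_id (V : opens X) (h : V `<=` V) (s : reg A V) : rres h s = s.
Proof.
apply: val_inj; apply/funext => y /=.
by congr (regfun s _); apply: val_inj.
Qed.

Lemma rres_comp (V W Z : opens X) (h : W `<=` V) (h' : Z `<=` W) (h'' : Z `<=` V)
  (s : reg A V) : rres h' (rres h s) = rres h'' s.
Proof.
apply: val_inj; apply/funext => y /=.
by congr (regfun s _); apply: val_inj.
Qed.

Definition struct_pmod : pmod A :=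
  @PMod A (fun V => (reg A V)^o) (fun V W h => @rres _ _ _ A V W h)
    struct_linear rres_id rres_comp.

End StructureSheaf.
End Modules.
Arguments struct_pmod {K n} X A.

Section StructureSheafIsSheaf.
Variables (K : fieldType) (n : nat) (X : set (pspace K n)) (A : comAlgType K).

Lemma struct_is_sheaf : is_sheaf (struct_pmod X A).
Proof.
move=> V I W h cv s compat.
have cv' (y : V) : exists i, oset (W i) (\val y) by apply: cv; exact: set_valP.
pose i y := sval (cid (cv' y)).
have ip y : oset (W (i y)) (\val y) by exact: svalP (cid (cv' y)).
pose at_ j (y : V) (m : oset (W j) (\val y)) : W j := exist _ (\val y) (mem_set m).
pose t (y : V) : A := regfun (s (i y)) (at_ (i y) y (ip y)).
have tE j (y : V) (m : oset (W j) (\val y)) : t y = regfun (s j) (at_ j y m).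
  have hi : ocap (W (i y)) (W j) `<=` W (i y) by move=> ? [].
  have hj : ocap (W (i y)) (W j) `<=` W j by move=> ? [].
  have yp : oset (ocap (W (i y)) (W j)) (\val y) by split; [exact: ip|].
  have := congr1 (fun r : reg A _ => regfun r (exist _ (\val y) (mem_set yp)))
    (compat (i y) j hi hj).
  rewrite /= /t => e; etransitivity; last (etransitivity; first exact: e).
    by congr (regfun _ _); apply: val_inj.
  by congr (regfun _ _); apply: val_inj.
have tr : t \in @regular_pred _ _ _ A V.
  apply/asboolP => x Vx; have [j Wx] := cv x Vx.
  have /asboolP/(_ x Wx)[Z [d [P [Q [Zx hP hQ rE]]]]] := valP (s j).
  exists (ocap Z (W j)), d, P, Q; split=> // y [Zy Wy].
  by rewrite (tE j y Wy); exact: (rE (at_ j y Wy)).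
exists (Reg tr); split=> [j|t' t'E].
  apply: val_inj; apply/funext => y /=.
  rewrite (tE j (incl (h j) y) (set_valP y)).
  by congr (regfun _ _); apply: val_inj.
apply: val_inj; apply/funext => y /=.
rewrite /t -(t'E (i y)) /=.
by congr (regfun _ _); apply: val_inj.
Qed.

Lemma struct_locally_free : locally_free (struct_pmod X A).
Proof.
move=> x; exists (oall X), 1%N, (fun=> (1 : reg A _)); split=> // W h s.
have e (r : 'I_1 -> reg A W) :
   \sum_i r i *: (@pres _ _ _ _ (struct_pmod X A) _ _ h (1 : reg A _)) = r ord0.
  rewrite big_ord1 /= rmorph1; exact: mulr1.
exists (fun=> s); split=> [|r ->]; first by rewrite e.
by rewrite e; apply/funext => j; rewrite (ord1 j).
Qed.
End StructureSheafIsSheaf.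


Section Endomorphisms.
Variables (K : fieldType) (n : nat) (X : set (pspace K n)).
Variables (A : comAlgType K) (E : pmod X A).

Section LocalEndomorphisms.
Variable V : opens X.

Record endo := Endo {
  eact : forall W : opens X, W `<=` V -> psec E W -> psec E W;
  eact_linear : forall (W : opens X) (h : W `<=` V) r s t,
    eact h (r *: s + t) = r *: eact h s + eact h t;
  eact_res : forall (W Z : opens X) (h : W `<=` V) (h' : Z `<=` V) (i : Z `<=` W) s,
    eact h' (pres i s) = pres i (eact h s)
}.
HB.instance Definition _ := gen_eqMixin endo.
HB.instance Definition _ := gen_choiceMixin endo.

Lemma endoP (a b : endo) :
  (forall (W : opens X) (h : W `<=` V) s, eact a h s = eact b h s) -> a = b.
Proof.
case: a b => [a la ra] [b lb rb] /= ab.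
have {}ab : a = b by do 3!apply: functional_extensionality_dep => ?; exact: ab.
by rewrite ab in la ra *; congr Endo; exact: Prop_irrelevance.
Qed.

Lemma pres_add (V1 W : opens X) (h : W `<=` V1) (s t : psec E V1) :
  pres h (s + t) = pres h s + pres h t.
Proof. by rewrite -[s]scale1r pres_linear rmorph1 !scale1r. Qed.

Lemma pres0 (V1 W : opens X) (h : W `<=` V1) : pres h 0 = 0 :> psec E W.
Proof. by apply: (addIr (pres h 0)); rewrite -pres_add !add0r. Qed.

Lemma pres_scale (V1 W : opens X) (h : W `<=` V1) r (s : psec E V1) :
  pres h (r *: s) = rres h r *: pres h s.
Proof. by rewrite -[r *: s]addr0 pres_linear pres0 addr0. Qed.

Lemma eact_add (a : endo) (W : opens X) (h : W `<=` V) (s t : psec E W) :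
  eact a h (s + t) = eact a h s + eact a h t.
Proof. by rewrite -[s]scale1r eact_linear !scale1r. Qed.

Program Definition endo_zero : endo := @Endo (fun W h s => 0) _ _.
Next Obligation. by rewrite scaler0 addr0. Qed.
Next Obligation. by rewrite pres0. Qed.

Program Definition endo_add (a b : endo) : endo :=
  @Endo (fun W h s => eact a h s + eact b h s) _ _.
Next Obligation. by rewrite !eact_linear scalerDr addrACA. Qed.
Next Obligation. by rewrite pres_add -!eact_res. Qed.

Program Definition endo_scale (r : reg A V) (a : endo) : endo :=
  @Endo (fun W h s => rres h r *: eact a h s) _ _.
Next Obligation. by rewrite eact_linear scalerDr !scalerA mulrC. Qed.
Next Obligation. by rewrite pres_scale (rres_comp _ _ h') -eact_res. Qed.

Lemma endo_addA : associative endo_add.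
Proof. by move=> a b c; apply: endoP => W h s /=; rewrite addrA. Qed.
Lemma endo_addC : commutative endo_add.
Proof. by move=> a b; apply: endoP => W h s /=; rewrite addrC. Qed.
Lemma endo_add0 : left_id endo_zero endo_add.
Proof. by move=> a; apply: endoP => W h s /=; rewrite add0r. Qed.
Lemma endo_addN : left_inverse endo_zero (endo_scale (-1)) endo_add.
Proof.
by move=> a; apply: endoP => W h s /=; rewrite rmorphN1 scaleN1r addNr.
Qed.
HB.instance Definition _ :=
  GRing.isZmodule.Build endo endo_addA endo_addC endo_add0 endo_addN.

Lemma endo_scaleA r r' (a : endo) :
  endo_scale r (endo_scale r' a) = endo_scale (r * r') a.
Proof. by apply: endoP => W h s /=; rewrite rmorphM scalerA. Qed.
Lemma endo_scale1 : left_id 1 endo_scale.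
Proof. by move=> a; apply: endoP => W h s /=; rewrite rmorph1 scale1r. Qed.
Lemma endo_scaleDr : right_distributive endo_scale +%R.
Proof. by move=> r a b; apply: endoP => W h s /=; rewrite scalerDr. Qed.
Lemma endo_scaleDl (a : endo) : {morph endo_scale^~ a : r r' / r + r'}.
Proof. by move=> r r'; apply: endoP => W h s /=; rewrite rmorphD scalerDl. Qed.
HB.instance Definition _ := GRing.Zmodule_isLmodule.Build (reg A V) endo
  endo_scaleA endo_scale1 endo_scaleDr endo_scaleDl.

End LocalEndomorphisms.

Program Definition endo_res (V W : opens X) (h : W `<=` V) (a : endo V) : endo W :=
  @Endo W (fun Z h' s => eact a (subset_trans h' h) s) _ _.
Next Obligation. by rewrite eact_linear. Qed.
Next Obligation. exact: eact_res. Qed.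

Lemma eact_irr (V W : opens X) (a : endo V) (h h' : W `<=` V) s :
  eact a h s = eact a h' s.
Proof. by rewrite (Prop_irrelevance h h'). Qed.

Lemma endo_res_linear (V W : opens X) (h : W `<=` V) r (a b : endo V) :
  endo_res h (r *: a + b) = rres h r *: endo_res h a + endo_res h b.
Proof. by apply: endoP => Z h' s /=; rewrite (rres_comp _ _ (subset_trans h' h)). Qed.

Lemma endo_res_id (V : opens X) (h : V `<=` V) (a : endo V) : endo_res h a = a.
Proof. by apply: endoP => Z h' s /=; exact: eact_irr. Qed.

Lemma endo_res_comp (V W Z : opens X) (h : W `<=` V) (h' : Z `<=` W)
  (h'' : Z `<=` V) (a : endo V) : endo_res h' (endo_res h a) = endo_res h'' a.
Proof. by apply: endoP => Y i s /=; exact: eact_irr. Qed.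

Definition end_pmod : pmod X A :=
  @PMod _ _ _ A (fun V => endo V) endo_res endo_res_linear endo_res_id endo_res_comp.

End Endomorphisms.


Section Cohomology.
Variables (K : fieldType) (n : nat) (X : set (pspace K n)).
Variables (A : comAlgType K) (F : pmod X A).

Definition ksec (V : opens X) : Type := psec F V.

Section KStructure.
Variable V : opens X.
HB.instance Definition _ := GRing.Zmodule.copy (ksec V) (psec F V).

Definition kscale (c : K) (s : ksec V) : ksec V := regc V c%:A *: (s : psec F V).

Lemma kscaleA c c' s : kscale c (kscale c' s) = kscale (c * c') s.
Proof. by rewrite /kscale scalerA -rmorphM /= mulr_algl scalerA. Qed.
Lemma kscale1 : left_id 1 kscale.
Proof. by move=> s; rewrite /kscale scale1r rmorph1 scale1r. Qed.
Lemma kscaleDr : right_distributive kscale +%R.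
Proof. by move=> c s t; rewrite /kscale scalerDr. Qed.
Lemma kscaleDl (s : ksec V) : {morph kscale^~ s : c c' / c + c'}.
Proof. by move=> c c'; rewrite /kscale scalerDl rmorphD scalerDl. Qed.
HB.instance Definition _ := GRing.Zmodule_isLmodule.Build K (ksec V)
  kscaleA kscale1 kscaleDr kscaleDl.
End KStructure.

Definition kres (V W : opens X) (h : W `<=` V) (s : ksec V) : ksec W :=
  @pres _ _ _ _ F V W h s.

Lemma kres_is_linear (V W : opens X) (h : W `<=` V) : linear (kres h).
Proof.
move=> c s t.
have e : rres h (regc V c%:A) = regc W c%:A :> reg A W by apply: val_inj.
by have := @pres_linear _ _ _ _ F V W h (regc V c%:A) s t; rewrite e.
Qed.
HB.instance Definition _ (V W : opens X) (h : W `<=` V) :=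
  GRing.isLinear.Build K (ksec V) (ksec W) *:%R (kres h) (kres_is_linear h).

Lemma kres_comp (V W Z : opens X) (h : W `<=` V) (h' : Z `<=` W)
  (h'' : Z `<=` V) (s : ksec V) : kres h' (kres h s) = kres h'' s.
Proof. exact: pres_comp. Qed.

(* Open covers are indexed by the points of X, with x in the x-th member;
   every open cover is refined by such a cover. *)
Record cover := Cover { cov :> X -> opens X; covP : forall x, oset (cov x) x }.

Definition refines (U' U : cover) : Prop := forall x : X, U' x `<=` U x.

Definition meet (U : cover) p (s : 'I_p -> X) : opens X :=
  obigcap (fun j => U (s j)).

Lemma meet_face (U : cover) p q (s : 'I_p -> X) (j : 'I_q -> 'I_p) :
  meet U s `<=` meet U (s \o j).
Proof. by move=> x Ux i; exact: Ux. Qed.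

Arguments meet_face U {p q} s j.

Lemma meet_refines (U' U : cover) (h : refines U' U) p (s : 'I_p -> X) :
  meet U' s `<=` meet U s.
Proof. by move=> x Ux i; exact: h. Qed.

Arguments meet_refines {U' U} h {p} s.

Definition cochain (U : cover) (p : nat) : Type :=
  forall s : 'I_p.+1 -> X, ksec (meet U s).
HB.instance Definition _ (U : cover) p := gen_eqMixin (cochain U p).
HB.instance Definition _ (U : cover) p := gen_choiceMixin (cochain U p).

Definition cdiff (U : cover) p (c : cochain U p) : cochain U p.+1 :=
  fun s => \sum_(j < p.+2) (-1) ^+ j *: kres (meet_face U s (lift j)) (c (s \o lift j)).

Definition crefine (U' U : cover) (h : refines U' U) p (c : cochain U p) :
  cochain U' p := fun s => kres (meet_refines h s) (c s).

Definition cocycle (U : cover) p (c : cochain U p) : Prop :=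
  forall s, cdiff c s = 0.

Definition coboundary (U : cover) p : cochain U p -> Prop :=
  match p with
  | 0 => fun c => forall s, c s = 0
  | q.+1 => fun c => exists b : cochain U q, forall s, c s = cdiff b s
  end.

Definition ccomb (U : cover) p (a : K) (c c' : cochain U p) : cochain U p :=
  fun s => a *: c s + c' s.

Lemma cdiff_comb (U : cover) p a (c c' : cochain U p) s :
  cdiff (ccomb a c c') s = a *: cdiff c s + cdiff c' s.
Proof.
rewrite /cdiff scaler_sumr -big_split; apply: eq_bigr => j _ /=.
by rewrite /ccomb linearP /= scalerDr !scalerA mulrC.
Qed.

Lemma cdiff_refine (U' U : cover) (h : refines U' U) p (c : cochain U p) s :
  cdiff (crefine h c) s = crefine h (cdiff c) s.
Proof.
rewrite /cdiff /crefine linear_sum; apply: eq_bigr => j _ /=.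
rewrite linearZ /=; congr (_ *: _).
have h'' : meet U' s `<=` meet U (s \o lift j).
  by apply: subset_trans (meet_face _ _ _); exact: meet_refines.
by rewrite !(kres_comp _ _ h'').
Qed.

Lemma coboundary_comb (U : cover) p a (c c' : cochain U p) :
  coboundary c -> coboundary c' -> coboundary (ccomb a c c').
Proof.
case: p c c' => [|p] c c' /=; first by move=> c0 c0' s; rewrite /ccomb c0 c0' scaler0 addr0.
move=> [b cb] [b' cb']; exists (ccomb a b b') => s.
by rewrite cdiff_comb /ccomb cb cb'.
Qed.

Lemma coboundary_refine (U' U : cover) (h : refines U' U) p (c : cochain U p) :
  coboundary c -> coboundary (crefine h c).
Proof.
case: p c => [|p] c /=; first by move=> c0 s; rewrite /crefine c0 linear0.
by move=> [b cb]; exists (crefine h b) => s; rewrite cdiff_refine /crefine cb.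
Qed.

Lemma coboundary0 (U : cover) p (c : cochain U p) :
  (forall s, c s = 0) -> coboundary c.
Proof.
case: p c => [//|p] c c0; exists (fun _ => 0) => s; rewrite c0.
by rewrite /cdiff big1 // => j _; rewrite linear0 scaler0.
Qed.

Record cocyc (p : nat) := Cocyc {
  czcov : cover;
  czval : cochain czcov p;
  czP : cocycle czval
}.
HB.instance Definition _ p := gen_eqMixin (cocyc p).
HB.instance Definition _ p := gen_choiceMixin (cocyc p).

Definition cohomologous p (z w : cocyc p) : Prop :=
  exists (U : cover) (hz : refines U (czcov z)) (hw : refines U (czcov w)),
    coboundary (ccomb (-1) (crefine hw (czval w)) (crefine hz (czval z))).

Definition cmeet (U U' : cover) : cover :=
  Cover (fun x => conj (covP U x) (covP U' x) : oset (ocap (U x) (U' x)) x).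

Lemma cmeetl (U U' : cover) : refines (cmeet U U') U.
Proof. by move=> x y []. Qed.
Lemma cmeetr (U U' : cover) : refines (cmeet U U') U'.
Proof. by move=> x y []. Qed.

Arguments cmeetl : clear implicits.
Arguments cmeetr : clear implicits.

Lemma refines_refl (U : cover) : refines U U.
Proof. by move=> x. Qed.

Lemma refines_trans (U V W : cover) : refines U V -> refines V W -> refines U W.
Proof. by move=> h h' x; apply: subset_trans (h x) (h' x). Qed.

Lemma crefine_comp (U V W : cover) (h : refines V W) (h' : refines U V)
  (h'' : refines U W) p (c : cochain W p) s :
  crefine h' (crefine h c) s = crefine h'' c s.
Proof. by rewrite /crefine (kres_comp _ _ (meet_refines h'' s)). Qed.

Lemma crefine_comb (U' U : cover) (h : refines U' U) p a (c c' : cochain U p) s :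
  crefine h (ccomb a c c') s = a *: crefine h c s + crefine h c' s.
Proof. exact: linearP. Qed.

Lemma coboundary_ext (U : cover) p (c c' : cochain U p) :
  (forall s, c s = c' s) -> coboundary c -> coboundary c'.
Proof.
case: p c c' => [|p] c c' cc' /=; first by move=> c0 s; rewrite -cc'.
by move=> [b cb]; exists b => s; rewrite -cc'.
Qed.

Lemma cohomologous_refl p (z : cocyc p) : cohomologous z z.
Proof.
exists (czcov z), (@refines_refl _), (@refines_refl _).
by apply: coboundary0 => s; rewrite /ccomb scaleN1r addNr.
Qed.

Lemma cohomologous_sym p (z w : cocyc p) : cohomologous z w -> cohomologous w z.
Proof.
move=> [U [hz [hw b]]]; exists U, hw, hz.
pose c0 : cochain U p := fun=> 0.
have b0 : coboundary c0 by apply: coboundary0.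
apply: coboundary_ext (coboundary_comb (-1) b b0) => s.
by rewrite /ccomb !scaleN1r opprD opprK addr0 addrC.
Qed.

Lemma cohomologous_trans p (w z t : cocyc p) :
  cohomologous z w -> cohomologous w t -> cohomologous z t.
Proof.
move=> [U [hz [hw b]]] [U' [hw' [ht b']]].
have r := cmeetl U U'; have r' := cmeetr U U'.
exists (cmeet U U'), (refines_trans r hz), (refines_trans r' ht).
apply: coboundary_ext (coboundary_comb 1 (coboundary_refine r b)
  (coboundary_refine r' b')) => s.
rewrite {1}/ccomb scale1r !crefine_comb /ccomb.
rewrite !(crefine_comp _ _ (refines_trans r hz)) !(crefine_comp _ _ (refines_trans r' ht)).
rewrite !(crefine_comp _ _ (refines_trans r hw)).
by rewrite !scaleN1r addrC -addrA; congr (_ + _); rewrite addrA subrr add0r.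
Qed.

Definition cohomologousb p : rel (cocyc p) := fun z w => `[< cohomologous z w >].

Lemma cohomologousb_refl p : reflexive (@cohomologousb p).
Proof. by move=> z; apply/asboolP; exact: cohomologous_refl. Qed.
Lemma cohomologousb_sym p : ssrbool.symmetric (@cohomologousb p).
Proof. by move=> z w; apply/asboolP/asboolP; exact: cohomologous_sym. Qed.
Lemma cohomologousb_trans p : transitive (@cohomologousb p).
Proof.
by move=> w z t /asboolP h /asboolP h'; apply/asboolP; exact: cohomologous_trans h'.
Qed.

Canonical cohomologous_equiv p := EquivRel (@cohomologousb p)
  (@cohomologousb_refl p) (@cohomologousb_sym p) (@cohomologousb_trans p).

(* Cech cohomology, as the colimit over all open covers of (cocycles modulo
   coboundaries); for coherent sheaves on a variety this is the derived functor
   cohomology. *)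
Definition cohom (p : nat) : Type := {eq_quot (@cohomologousb p)}.
HB.instance Definition _ p := Choice.on (cohom p).

Definition cclass p (z : cocyc p) : cohom p := \pi_{eq_quot (@cohomologousb p)} z.
Definition crepr p (a : cohom p) : cocyc p := repr a.

Lemma creprK p (a : cohom p) : cclass (crepr a) = a.
Proof. exact: reprK. Qed.

Lemma cclass_eq p (z w : cocyc p) : cclass z = cclass w <-> cohomologous z w.
Proof.
split=> [/eqmodP/asboolP //|zw]; apply/eqmodP; exact/asboolP.
Qed.

Section VectorSpace.
Variable p : nat.

Program Definition cocyc_comb (a : K) (z w : cocyc p) : cocyc p :=
  @Cocyc p (cmeet (czcov z) (czcov w))
    (ccomb a (crefine (cmeetl _ _) (czval z)) (crefine (cmeetr _ _) (czval w))) _.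
Next Obligation.
move=> s; rewrite cdiff_comb !cdiff_refine /crefine !czP.
by rewrite !linear0 ?scaler0 addr0.
Qed.

Program Definition cocyc0 : cocyc p :=
  @Cocyc p (@Cover (fun=> oall X) (fun=> I)) (fun=> 0) _.
Next Obligation.
by move=> s; rewrite /cdiff big1 // => j _; rewrite linear0 scaler0.
Qed.

Lemma cclass_eqI (z w : cocyc p) :
  (exists (U : cover) (hz : refines U (czcov z)) (hw : refines U (czcov w)),
    forall s, crefine hz (czval z) s = crefine hw (czval w) s) ->
  cclass z = cclass w.
Proof.
move=> [U [hz [hw zw]]]; apply/cclass_eq; exists U, hz, hw; apply: coboundary0 => s.
by rewrite /ccomb zw scaleN1r addNr.
Qed.

Lemma cclass_comb (a : K) (z z' w w' : cocyc p) :
  cclass z = cclass z' -> cclass w = cclass w' ->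
  cclass (cocyc_comb a z w) = cclass (cocyc_comb a z' w').
Proof.
move=> /cclass_eq[U [h [h' b]]] /cclass_eq[U' [k [k' b']]]; apply/cclass_eq.
have r := cmeetl U U'; have r' := cmeetr U U'.
have e : refines (cmeet U U') (cmeet (czcov z) (czcov w)).
  by move=> x y [Uy U1y]; split; [exact: (h x)|exact: (k x)].
have e' : refines (cmeet U U') (cmeet (czcov z') (czcov w')).
  by move=> x y [Uy U1y]; split; [exact: (h' x)|exact: (k' x)].
exists (cmeet U U'), e, e'.
apply: coboundary_ext (coboundary_comb a (coboundary_refine r b)
  (coboundary_refine r' b')) => s.
rewrite {1}/ccomb [RHS]/ccomb /= !crefine_comb.
rewrite !(crefine_comp _ _ (refines_trans r h)) !(crefine_comp _ _ (refines_trans r h')).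
rewrite !(crefine_comp _ _ (refines_trans r' k)) !(crefine_comp _ _ (refines_trans r' k')).
by rewrite !scaleN1r scalerDr scalerN opprD addrACA.
Qed.

Definition hcomb (a : K) (x y : cohom p) : cohom p :=
  cclass (cocyc_comb a (crepr x) (crepr y)).

Lemma hcombE a z w : hcomb a (cclass z) (cclass w) = cclass (cocyc_comb a z w).
Proof. by apply: cclass_comb; rewrite creprK. Qed.

Definition hzero := cclass cocyc0.
Definition hadd := hcomb 1.
Definition hscale a x := hcomb a x hzero.
Definition hopp := hscale (-1).

Lemma cohomW (P : cohom p -> Prop) : (forall z, P (cclass z)) -> forall x, P x.
Proof. by move=> Pz x; rewrite -[x]creprK. Qed.

Lemma crefine0 (U' U : cover) (h : refines U' U) (c : cochain U p) s :
  (forall t, c t = 0) -> crefine h c s = 0.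
Proof. by move=> c0; rewrite /crefine c0 linear0. Qed.

Lemma haddA : associative hadd.
Proof.
apply: cohomW => z; apply: cohomW => w; apply: cohomW => t.
rewrite /hadd !hcombE.
set U := cmeet (czcov z) (cmeet (czcov w) (czcov t)).
have hz : refines U (czcov z) by move=> x y [].
have hw : refines U (czcov w) by move=> x y [_ []].
have ht : refines U (czcov t) by move=> x y [_ []].
have h1 : refines U (cmeet (czcov z) (cmeet (czcov w) (czcov t))) by move=> x y [? []].
have h2 : refines U (cmeet (cmeet (czcov z) (czcov w)) (czcov t)) by move=> x y [? []].
have h3 : refines U (cmeet (czcov w) (czcov t)) by move=> x y [? []].
have h4 : refines U (cmeet (czcov z) (czcov w)) by move=> x y [? []].
apply: cclass_eqI; exists U, h1, h2 => s /=.
rewrite !crefine_comb !(crefine_comp _ _ h3) !(crefine_comp _ _ h4) !crefine_comb.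
by rewrite !(crefine_comp _ _ hz) !(crefine_comp _ _ hw) !(crefine_comp _ _ ht) !scale1r addrA.
Qed.

Lemma haddC : commutative hadd.
Proof.
apply: cohomW => z; apply: cohomW => w; rewrite /hadd !hcombE.
set U := cmeet (czcov z) (czcov w).
have hz : refines U (czcov z) by move=> x y [].
have hw : refines U (czcov w) by move=> x y [].
have h1 : refines U (cmeet (czcov w) (czcov z)) by move=> x y [].
apply: cclass_eqI; exists U, (@refines_refl _), h1 => s /=.
rewrite !crefine_comb.
by rewrite !(crefine_comp _ _ hz) !(crefine_comp _ _ hw) !scale1r addrC.
Qed.

Lemma hadd0 : left_id hzero hadd.
Proof.
apply: cohomW => z; rewrite /hadd /hzero !hcombE.
have h1 : refines (czcov z) (cmeet (czcov cocyc0) (czcov z)) by move=> x y.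
apply: cclass_eqI; exists (czcov z), h1, (@refines_refl _) => s /=.
rewrite crefine_comb !(crefine_comp _ _ (@refines_refl _)) scale1r.
by rewrite crefine0 ?add0r // => t; apply: crefine0.
Qed.

Lemma haddN : left_inverse hzero hopp hadd.
Proof.
apply: cohomW => z; rewrite /hopp /hscale /hzero /hadd !hcombE.
set U := czcov z; have hz : refines U (czcov z) by move=> x y.
have h1 : refines U (cmeet (cmeet (czcov z) (czcov cocyc0)) (czcov z)) by move=> x y.
have h2 : refines U (cmeet (czcov z) (czcov cocyc0)) by move=> x y.
have h3 : refines U (czcov cocyc0) by move=> x y.
apply: cclass_eqI; exists U, h1, h3 => s /=.
rewrite crefine_comb !(crefine_comp _ _ h2) crefine_comb !(crefine_comp _ _ hz).
rewrite !(crefine_comp _ _ h3) !(@crefine0 _ _ h3 (fun=> 0)) //.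
by rewrite scale1r scaleN1r addr0 addNr.
Qed.

HB.instance Definition _ := GRing.isZmodule.Build (cohom p) haddA haddC hadd0 haddN.

Lemma hscaleA a b x : hscale a (hscale b x) = hscale (a * b) x.
Proof.
move: x; apply: cohomW => z; rewrite /hscale /hzero !hcombE.
set U := czcov z; have hz : refines U (czcov z) by move=> x y.
have h1 : refines U (cmeet (cmeet (czcov z) (czcov cocyc0)) (czcov cocyc0)) by move=> x y.
have h2 : refines U (cmeet (czcov z) (czcov cocyc0)) by move=> x y.
have h3 : refines U (czcov cocyc0) by move=> x y.
apply: cclass_eqI; exists U, h1, h2 => s /=.
rewrite !crefine_comb !(crefine_comp _ _ h2) crefine_comb !(crefine_comp _ _ hz).
by rewrite !(crefine_comp _ _ h3) !(@crefine0 _ _ h3 (fun=> 0)) // !addr0 scalerA.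
Qed.

Lemma hscale1 : left_id 1 hscale.
Proof.
apply: cohomW => z; rewrite /hscale /hzero !hcombE.
set U := czcov z; have hz : refines U (czcov z) by move=> x y.
have h2 : refines U (cmeet (czcov z) (czcov cocyc0)) by move=> x y.
have h3 : refines U (czcov cocyc0) by move=> x y.
apply: cclass_eqI; exists U, h2, hz => s /=.
rewrite crefine_comb !(crefine_comp _ _ hz) !(crefine_comp _ _ h3).
by rewrite (@crefine0 _ _ h3 (fun=> 0)) // addr0 scale1r.
Qed.

Lemma hscaleDr : right_distributive hscale +%R.
Proof.
move=> a; apply: cohomW => z; apply: cohomW => w.
rewrite -![_ + _]/(hadd _ _) /hscale /hzero /hadd !hcombE.
set U := cmeet (czcov z) (czcov w); set O := czcov cocyc0.
have hz : refines U (czcov z) by move=> x y [].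
have hw : refines U (czcov w) by move=> x y [].
have h0 : refines U O by move=> x y.
have h1 : refines U (cmeet U O) by move=> x y.
have h2 : refines U (cmeet (cmeet (czcov z) O) (cmeet (czcov w) O)) by move=> x y [].
have h3 : refines U (cmeet (czcov z) O) by move=> x y [].
have h4 : refines U (cmeet (czcov w) O) by move=> x y [].
have h5 : refines U U by move=> x y.
apply: cclass_eqI; exists U, h1, h2 => s /=.
rewrite !crefine_comb !(crefine_comp _ _ h5) !(crefine_comp _ _ h3) !(crefine_comp _ _ h4).
rewrite !crefine_comb !(crefine_comp _ _ hz) !(crefine_comp _ _ hw) !(crefine_comp _ _ h0).
by rewrite !(@crefine0 _ _ h0 (fun=> 0)) // !addr0 !scale1r scalerDr.
Qed.

Lemma hscaleDl x : {morph hscale^~ x : a b / a + b}.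
Proof.
move=> a b; move: x; apply: cohomW => z.
rewrite -![hscale _ _ + _]/(hadd _ _) /hscale /hzero /hadd !hcombE.
set U := czcov z; set O := czcov cocyc0.
have hz : refines U (czcov z) by move=> x y.
have h0 : refines U O by move=> x y.
have h1 : refines U (cmeet U O) by move=> x y.
have h2 : refines U (cmeet (cmeet U O) (cmeet U O)) by move=> x y.
apply: cclass_eqI; exists U, h1, h2 => s /=.
rewrite !crefine_comb !(crefine_comp _ _ h1) !crefine_comb.
rewrite !(crefine_comp _ _ hz) !(crefine_comp _ _ h0).
by rewrite !(@crefine0 _ _ h0 (fun=> 0)) // !addr0 !scale1r scalerDl.
Qed.

HB.instance Definition _ := GRing.Zmodule_isLmodule.Build K (cohom p)
  hscaleA hscale1 hscaleDr hscaleDl.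

Lemma cclass_linear a z w :
  cclass (cocyc_comb a z w) = a *: cclass z + cclass w :> cohom p.
Proof.
rewrite -[RHS]/(hadd (hscale a (cclass z)) (cclass w)) /hadd /hscale /hzero !hcombE.
set U := cmeet (czcov z) (czcov w); set O := czcov cocyc0.
have hz : refines U (czcov z) by move=> x y [].
have hw : refines U (czcov w) by move=> x y [].
have h0 : refines U O by move=> x y.
have h1 : refines U U by move=> x y.
have h2 : refines U (cmeet (cmeet (czcov z) O) (czcov w)) by move=> x y [].
have h3 : refines U (cmeet (czcov z) O) by move=> x y [].
apply: cclass_eqI; exists U, h1, h2 => s /=.
rewrite !crefine_comb !(crefine_comp _ _ h3) crefine_comb.
rewrite !(crefine_comp _ _ hz) !(crefine_comp _ _ hw) !(crefine_comp _ _ h0).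
by rewrite (@crefine0 _ _ h0 (fun=> 0)) // addr0 scale1r.
Qed.

End VectorSpace.
End Cohomology.


Section Grassmannian.
Variables (K : fieldType) (V : lmodType K) (k : nat).

Definition lin_indep (b : 'I_k -> V) : Prop :=
  forall c : 'I_k -> K, \sum_i c i *: b i = 0 -> forall i, c i = 0.

Definition is_basis (b : 'I_k -> V) (U : set V) : Prop :=
  lin_indep b /\ U = [set v | exists c : 'I_k -> K, v = \sum_i c i *: b i].

Record Gr := MkGr { gset :> set V; gsetP : exists b, is_basis b gset }.

Definition gbasis (U : Gr) : 'I_k -> V := sval (cid (gsetP U)).

Lemma gbasisP (U : Gr) : is_basis (gbasis U) U.
Proof. exact: svalP (cid (gsetP U)). Qed.

Section Subspace.
Variable U : Gr.

Definition gpred : {pred V} := fun v => v \in gset U.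

Lemma gpred_closed : submod_closed gpred.
Proof.
have [_ UE] := gbasisP U; have UP v : v \in gpred <-> exists c, v = \sum_i c i *: gbasis U i.
  by rewrite -topredE /= /gpred UE; split=> [/set_mem|/mem_set].
split; first by apply/UP; exists (fun=> 0); rewrite big1 // => i _; rewrite scale0r.
move=> a v w /UP[c ->] /UP[d ->]; apply/UP; exists (fun i => a * c i + d i).
rewrite scaler_sumr -big_split; apply: eq_bigr => i _ /=.
by rewrite scalerDl scalerA.
Qed.

Record gsub := GSub { gval :> V; _ : gval \in gpred }.
HB.instance Definition _ := [isSub for gval].
HB.instance Definition _ := [Choice of gsub by <:].
HB.instance Definition _ := GRing.isSubmodClosed.Build K V gpred
  (GRing.submod_closed_semi gpred_closed).
HB.instance Definition _ := [SubChoice_isSubLmodule of gsub by <:].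

End Subspace.
End Grassmannian.


Section CupProduct.
Variables (K : fieldType) (n : nat) (X : set (pspace K n)).
Variables (A : comAlgType K) (E : pmod X A).

(* h^0(X, E) >= k *)
Definition h0_ge (k : nat) : Prop := exists b : 'I_k -> ksec E (oall X), lin_indep b.

Lemma subT (V : opens X) : V `<=` oall X.
Proof. by []. Qed.

Definition H0 : lmodType K := ksec E (oall X).

Definition cup_cochain (z : cocyc (end_pmod E) 1) (s : H0) :
    cochain E (czcov z) 1 :=
  fun t => eact (czval z t : endo E _) (@subset_refl _ _)
             (pres (@subT _) (s : psec E (oall X))).

Lemma kresE (F : pmod X A) (V W : opens X) (h : W `<=` V) (s : ksec F V) :
  kres h s = pres h (s : psec F V).
Proof. by []. Qed.

Lemma eact_kscale (V : opens X) (a : K) (g : ksec (end_pmod E) V)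
  (W : opens X) (h : W `<=` V) (s : ksec E W) :
  eact (a *: g : endo E V) h s = a *: (eact (g : endo E V) h s : ksec E W).
Proof.
rewrite -[LHS]/(rres h (regc V a%:A) *: eact (g : endo E V) h s).
rewrite -[RHS]/(regc W a%:A *: (eact (g : endo E V) h s : psec E W)).
by congr (_ *: _); apply: val_inj.
Qed.

Lemma eact_sum (V : opens X) I (r : seq I) (g : I -> ksec (end_pmod E) V)
  (W : opens X) (h : W `<=` V) (s : psec E W) :
  eact (\sum_(i <- r) g i : endo E V) h s =
  \sum_(i <- r) eact (g i : endo E V) h s.
Proof.
elim: r => [|i r IH]; first by rewrite !big_nil.
by rewrite !big_cons -IH.
Qed.

Lemma cup_cocycle z s : cocycle (cup_cochain z s).
Proof.
move=> t; set W := meet (czcov z) t.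
pose s' : psec E W := pres (@subT _) (s : psec E (oall X)).
have e : eact (cdiff (czval z) t : endo E W) (@subset_refl _ _) s' = 0.
  by rewrite (czP z t).
rewrite -[RHS]e /cdiff eact_sum; apply: eq_bigr => j _.
rewrite eact_kscale; congr (_ *: _).
set f := @meet_face K n X (czcov z) _ _ t (lift j).
rewrite (kresE (F := E)) /cup_cochain -(eact_res _ _ f f) (pres_comp _ _ (@subT _)).
exact: eact_irr.
Qed.

Definition cup (z : cocyc (end_pmod E) 1) (s : H0) : cocyc E 1 :=
  Cocyc (cup_cocycle z s).

Variables (k : nat) (U : Gr H0 k).

Lemma cup_cochain_linear z (a : K) (s t : H0) w :
  cup_cochain z (a *: s + t) w = a *: cup_cochain z s w + cup_cochain z t w.
Proof.
set W := meet _ w; pose f := @subT W.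
have e : pres f (a *: s + t : psec E (oall X)) =
    regc W a%:A *: pres f (s : psec E (oall X)) + pres f (t : psec E (oall X)).
  by rewrite -[a *: s]/(regc _ a%:A *: (s : psec E (oall X))) pres_linear;
    congr (_ *: _ + _); apply: val_inj.
by rewrite /cup_cochain e eact_linear.
Qed.

Definition alpha (a : cohom (end_pmod E) 1) : gsub U -> cohom E 1 :=
  fun u => cclass (cup (crepr a) (gval u)).

Lemma alpha_is_linear a : linear (alpha a).
Proof.
move=> c u v; rewrite /alpha -cclass_linear; apply: cclass_eqI.
set z := crepr a.
have h : refines (czcov z) (cmeet (czcov z) (czcov z)) by move=> x y.
have h0 : refines (czcov z) (czcov z) by move=> x y.
exists (czcov z), h0, h => s /=.
rewrite (crefine_comb (F := E)) !(crefine_comp _ _ h0) /crefine.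
by rewrite cup_cochain_linear linearP.
Qed.
HB.instance Definition _ a :=
  GRing.isLinear.Build K (gsub U) (cohom E 1) *:%R (alpha a) (alpha_is_linear a).

(* alpha does not depend on the choice of cocycles. *)
Lemma alphaE (z : cocyc (end_pmod E) 1) (u : gsub U) :
  alpha (cclass z) u = cclass (cup z (gval u)).
Proof.
apply/cclass_eq; have : cohomologous (crepr (cclass z)) z.
  by apply/cclass_eq; rewrite creprK.
move: (crepr _) => z' [W [h' [h [b bE]]]]; exists W, h', h.
pose cupc (V : cover X) p (c : cochain (end_pmod E) V p) : cochain E V p :=
  fun t => eact (c t : endo E _) (@subset_refl _ _)
    (pres (@subT _) (gval u : psec E (oall X))).
have cup_res (V V' : opens X) (i : V' `<=` V) (c : ksec (end_pmod E) V) :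
    eact (kres i c : endo E V') (@subset_refl _ _)
      (pres (@subT _) (gval u : psec E (oall X))) =
    kres i (eact (c : endo E V) (@subset_refl _ _)
      (pres (@subT _) (gval u : psec E (oall X))) : ksec E V).
  rewrite (kresE (F := E)) -(eact_res _ _ i i) (pres_comp _ _ (@subT _)).
  by rewrite /kres /= (eact_irr _ _ i).
exists (cupc _ _ b) => s.
have := congr1 (fun e : ksec (end_pmod E) (meet W s) =>
  eact (e : endo E _) (@subset_refl _ _)
    (pres (@subT _) (gval u : psec E (oall X)))) (bE s).
rewrite /cdiff eact_sum => e; rewrite /ccomb /crefine /= /cup_cochain -!cup_res.
rewrite -eact_kscale; transitivity (\sum_(j < 2) eact ((-1) ^+ j *:
  kres (@meet_face K n X W _ _ s (lift j)) (b (s \o lift j)) : endo E (meet W s))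
  (@subset_refl _ _) (pres (@subT _) (gval u : psec E (oall X)))); first exact: e.
by apply: eq_bigr => j _; rewrite eact_kscale cup_res.
Qed.

Definition alpha_surjective : Prop :=
  forall f : {linear gsub U -> cohom E 1}, exists a, forall u, alpha a u = f u.

(* Hom(U, H^1(X, E)) = 0. *)
Definition hom_H1_zero : Prop :=
  forall (f : {linear gsub U -> cohom E 1}) u, f u = 0.

End CupProduct.


Section ArtinianAlgebras.
Variable K : fieldType.

Definition is_ideal (A : comAlgType K) (I : set A) : Prop :=
  [/\ I 0, forall x y, I x -> I y -> I (x + y) & forall a x, I x -> I (a * x)].

Definition artinian (A : comAlgType K) : Prop :=
  forall I : nat -> set A, (forall i, is_ideal (I i)) ->
    (forall i, I i.+1 `<=` I i) ->
  exists N, forall i, (N <= i)%N -> I i = I N.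

(* aug is the reduction modulo the maximal ideal. *)
Record artAlg := ArtAlg {
  art_alg :> comAlgType K;
  aug : {lrmorphism art_alg -> (K^o : comAlgType K)};
  art_local : forall x, aug x != 0 -> exists y, x * y = 1;
  art_artinian : artinian art_alg
}.

(* The set-valued functors are given by their values and by the graphs of the
   maps F(B) -> F(A). *)
Record set_functor := SetFunctor {
  fob : artAlg -> Type;
  fmap : forall B A : artAlg, {lrmorphism B -> A} -> fob B -> fob A -> Prop
}.

Definition smooth (F : set_functor) : Prop :=
  forall (B A : artAlg) (f : {lrmorphism B -> A}),
    (forall a : A, exists b : B, f b = a) ->
  forall y : fob F A, exists x : fob F B, fmap f x y.

(* Objects over each A, their isomorphisms, and the relation saying that an
   object over A is the base change of an object over B. *)
Record moduli := Moduli {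
  mob : artAlg -> Type;
  miso : forall A, mob A -> mob A -> Prop;
  mbc : forall B A : artAlg, {lrmorphism B -> A} -> mob B -> mob A -> Prop
}.

Record iso_class (M : moduli) (A : artAlg) := IsoClass {
  cset : mob M A -> Prop;
  csetP : exists x, cset = miso x
}.

Definition iso_class_of (M : moduli) (A : artAlg) (x : mob M A) : iso_class M A :=
  @IsoClass M A (@miso M A x) (ex_intro _ x erefl).

Definition iso_functor (M : moduli) : set_functor :=
  @SetFunctor (iso_class M) (fun B A f b a =>
    exists x y, [/\ cset b x, cset a y & mbc f x y]).

Definition subfunctor (F : set_functor) (P : forall A, fob F A -> Prop) : set_functor :=
  @SetFunctor (fun A => {y : fob F A | P A y})
    (fun B A f x y => fmap f (sval x) (sval y)).

End ArtinianAlgebras.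


Section Deformations.
Variables (K : fieldType) (n : nat) (X : set (pspace K n)).
Variable E : pmod X (K^o : comAlgType K).

(* X x Spec A has the same underlying space as X, with structure sheaf
   O_X (x)_K A. *)
Record deformation (A : artAlg K) := Deformation {
  dsheaf :> pmod X A;
  dsheafP : is_sheaf dsheaf;
  dlocfree : locally_free dsheaf;
  dpi : smor (aug A) dsheaf E;
  dpiP : is_base_change dpi
}.

Definition def_iso_by (A : artAlg K) (D D' : deformation A) (phi : mor D D') : Prop :=
  mor_iso phi /\ forall V s, dpi D' V (phi V s) = dpi D V s.

Definition def_iso (A : artAlg K) (D D' : deformation A) : Prop :=
  exists phi : mor D D', def_iso_by phi.

Definition def_bc_by (B A : artAlg K) (f : {lrmorphism B -> A})
    (D : deformation B) (D' : deformation A) (p : smor f D D') : Prop :=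
  is_base_change p /\ forall V s, dpi D' V (p V s) = dpi D V s.

Definition def_bc (B A : artAlg K) (f : {lrmorphism B -> A})
    (D : deformation B) (D' : deformation A) : Prop :=
  exists p : smor f D D', def_bc_by p.

Definition moduli_E : moduli K := @Moduli K deformation def_iso def_bc.

Definition Def_E : set_functor K := iso_functor moduli_E.

Section Pairs.
Variables (k : nat) (U : Gr (H0 E) k).

(* U (x)_K A is the free A-module 'rV[A]_k, with standard basis the tensors
   u_j (x) 1, where u_j = gbasis U j. *)

(* The reduction U (x) A -> U followed by the inclusion in H^0(X, E). *)
Definition tens_red (A : artAlg K) (u : 'rV[A]_k) : H0 E :=
  \sum_j (aug A (u 0 j) : K) *: gbasis U j.

Record pair_deformation (A : artAlg K) := PairDeformation {
  pdef :> deformation A;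
  pdi : 'rV[A]_k -> gsec pdef;
  pdi_linear : forall (a : A) u v, pdi (a *: u + v) = regc _ a *: pdi u + pdi v;
  pdi_red : forall u, dpi pdef (oall X) (pdi u) = tens_red u
}.

Definition pair_iso (A : artAlg K) (D D' : pair_deformation A) : Prop :=
  exists (phi : mor D D') (psi : {linear 'rV[A]_k -> 'rV[A]_k}),
    [/\ def_iso_by phi, bijective psi &
        forall u, phi (oall X) (pdi D u) = pdi D' (psi u)].

Definition pair_bc (B A : artAlg K) (f : {lrmorphism B -> A})
    (D : pair_deformation B) (D' : pair_deformation A) : Prop :=
  exists p : smor f D D', def_bc_by p /\
    forall u, p (oall X) (pdi D u) = pdi D' (map_mx f u).

Definition moduli_EU : moduli K := @Moduli K pair_deformation pair_iso pair_bc.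

Definition Def_EU : set_functor K := iso_functor moduli_EU.

End Pairs.

Lemma rmap_id (A : comAlgType K) (V : opens X) (r : reg A V) :
  rmap idfun r = r.
Proof. exact: val_inj. Qed.

Lemma def_iso_trans (A : artAlg K) (D D' D'' : deformation A) :
  def_iso D D' -> def_iso D' D'' -> def_iso D D''.
Proof.
move=> [phi [b e]] [phi' [b' e']].
have lin V r (s t : psec D V) : phi' V (phi V (r *: s + t)) =
    rmap idfun r *: phi' V (phi V s) + phi' V (phi V t).
  by rewrite !smap_linear !rmap_id.
have res (V W : opens X) (h : W `<=` V) (s : psec D V) :
    phi' W (phi W (pres h s)) = pres h (phi' V (phi V s)).
  by rewrite !smap_res.
exists (@SMor _ _ _ _ _ idfun D D'' (fun V s => phi' V (phi V s)) lin res).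
split=> [V|V s] /=; last by rewrite e' e.
exact: (bij_comp (b' V) (b V)).
Qed.

Lemma def_iso_refl (A : artAlg K) (D : deformation A) : def_iso D D.
Proof.
have lin V r (s t : psec D V) : r *: s + t = rmap idfun r *: s + t.
  by rewrite rmap_id.
exists (@SMor _ _ _ _ _ idfun D D (fun V s => s) lin (fun _ _ _ _ => erefl)).
by split=> // V; exists id.
Qed.

Lemma pair_iso_refl (k : nat) (U : Gr (H0 E) k) (A : artAlg K)
  (D : pair_deformation U A) : pair_iso D D.
Proof.
have lin V r (s t : psec D V) : r *: s + t = rmap idfun r *: s + t.
  by rewrite rmap_id.
exists (@SMor _ _ _ _ _ idfun D D (fun V s => s) lin (fun _ _ _ _ => erefl)), idfun.
by split=> //; split=> // V; exists id.
Qed.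

Section Forget.
Variables (k : nat) (U : Gr (H0 E) k) (A : artAlg K).

Lemma forget_class (c : fob (Def_EU U) A) :
  exists x : deformation A,
    (fun y => exists2 z : pair_deformation U A, cset c z & def_iso (pdef z) y) =
    def_iso x.
Proof.
have [z0 cE] := csetP c; exists (pdef z0).
apply: functional_extensionality_dep => y; apply: propositional_extensionality.
split=> [[z]|z0y].
  rewrite cE /= => -[phi [psi [phiP _ _]]] zy.
  by apply: def_iso_trans zy; exists phi.
by exists z0 => //; rewrite cE; exact: pair_iso_refl.
Qed.

(* The class obtained by forgetting the sections. *)
Definition r_U (c : fob (Def_EU U) A) : fob Def_E A :=
  @IsoClass _ moduli_E A _ (forget_class c).

End Forget.

(* Def^k_E(A) is the union of the r_U (Def_(E, U)(A)). *)
Definition Def_k (k : nat) : set_functor K :=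
  @subfunctor _ Def_E (fun A y =>
    exists (U : Gr (H0 E) k) (c : fob (Def_EU U) A), r_U c = y).

End Deformations.
Arguments h0_ge {K n X A} E k.
Arguments Def_k {K n X} E k.

(* Main.v *)
(* If k > 0, then Hom(U, H^1(X, E)) = 0 forces H^1(X, E) = 0, and the point is
   that H^0(E_B) -> H^0(E_A) is then surjective for every base change of
   deformations along a surjection f : B -> A. Lift a section locally; the
   differences of the local lifts lie in J E_B with J = ker f. A K-linear form on
   J / m J, nonzero for J <> 0 by Nakayama's lemma, turns these differences into
   a Cech 1-cocycle of E; writing it as a coboundary and correcting the lifts
   makes J strictly smaller, and the descending chain condition ends the process.
   So the sections i_A extend along E_B -> E_A and along E_A -> E, which gives
   both directions of the first equivalence and the surjectivity of r_U, that is,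
   Def^k_E = Def_E. For k = 0 there are no sections to extend. *)

Require Import Defs.
From HB Require Import structures.
From mathcomp Require Import all_boot all_order all_algebra.
From mathcomp Require Import boolp classical_sets functions.
From mathcomp Require Import mpoly.

Set Implicit Arguments.
Unset Strict Implicit.
Unset Printing Implicit Defensive.

Import GRing.Theory.
Local Open Scope classical_set_scope.
Local Open Scope ring_scope.

(** * Ideals of a local Artinian algebra *)

Section LinearFunctionals.
Variables (K : fieldType) (V : lmodType K).

(** Base change is available only through its universal property, so everything concrete about a
    base change [p] is extracted by mapping to test sheaves: existence of the induced morphism shows
    that the images of a frame are independent, uniqueness that they generate near each point. These
    two facts do the work of an identification with a tensor product, and the reduction to [E] is
    one more instance of them. The descent does not factor B -> A into small extensions, which would
    require a deformation over every intermediate quotient. All lifts remain sections of the one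
    sheaf over [B], and only the ideal bounding their differences shrinks. As [J] need not be killed
    by the maximal ideal m, the differences are turned into sections of [E] by a functional on [J]
    that vanishes on m J. Its kernel in [J] is again an ideal, of codimension one, and serves as the
    next bound. *)

Definition subspace (S : set V) : Prop :=
  S 0 /\ forall c x y, S x -> S y -> S (c *: x + y).

Lemma subspace_combination (S : set V) c d x y :
  subspace S -> S x -> S y -> S (c *: x + d *: y).
Proof.
move=> [S0 Sl] Sx Sy; apply: (Sl) => //.
by rewrite -[d *: y]addr0; apply: Sl.
Qed.

Lemma maximal_subspace_avoiding (S : set V) (a : V) : subspace S -> ~ S a ->
  exists H : set V, [/\ subspace H, S `<=` H, ~ H a &
    forall v, exists c, H (v - c *: a)].
Proof.
move=> [S0 Sl] Sa.
(* [S] is adjoined to each [T] so that the union of the empty chain, the empty set, still belongs to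
   [P]. *)
pose P := [set T : set V | (forall c x y, (S `|` T) x -> (S `|` T) y ->
  (S `|` T) (c *: x + y)) /\ ~ (S `|` T) a].
have [F FP Ftot|T [[Tl Ta] Tmax]] := @Zorn_bigcup V P.
  split=> [c x y|].
    have mono (Z : set V) : F Z ->
        S `|` Z `<=` S `|` \bigcup_(Z in F) Z.
      by move=> FZ z [Sz|Zz]; [left|right; exists Z].
    case=> [Sx|[X1 FX1 X1x]] [Sy|[X2 FX2 X2y]].
    - by left; apply: Sl.
    - by apply: (mono _ FX2); apply: (FP _ FX2).1; [left|right].
    - by apply: (mono _ FX1); apply: (FP _ FX1).1; [right|left].
    - have [X12|X21] := Ftot _ _ FX1 FX2.
        by apply: (mono _ FX2); apply: (FP _ FX2).1; right=> //; apply: X12.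
      by apply: (mono _ FX1); apply: (FP _ FX1).1; right=> //; apply: X21.
  by case=> [//|[X1 FX1 X1a]]; apply: (FP _ FX1).2; right.
pose H := S `|` T.
have H0 : H 0 by left.
have HS : subspace H by split.
exists H; split=> // [x Sx|v]; first by left.
have [Hv|Hv] := pselect (H v); first by exists 0; rewrite scale0r subr0.
(* [T'] is H + K v. It is strictly larger than [H], so by maximality it contains [a]; solving that
   relation for [v] gives the coefficient. *)
pose T' := [set z | exists c h, H h /\ z = h + c *: v].
have TT' : H `<=` T' by move=> h Hh; exists 0, h; rewrite scale0r addr0.
have ST' : S `|` T' = T'.
  by apply/seteqP; split=> z; [case=> // Sz; apply: TT'; left|right].
have [c [h [Hh ahv]]] : T' a.
  apply: contrapT => T'a; apply: (Tmax T').
    split=> [z Tz|TT]; first by apply: TT'; right.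
    by apply: Hv; right; apply: TT; exists 1, 0; rewrite scale1r add0r.
  rewrite /P /mkset ST'; split=> // d _ _ [c1 [h1 [Hh1 ->]]] [c2 [h2 [Hh2 ->]]].
  exists (d * c1 + c2), (d *: h1 + h2); split; first exact: Tl.
  by rewrite scalerDr scalerA scalerDl addrACA.
have c0 : c != 0.
  by apply: contra_notN Ta => /eqP c0; rewrite ahv c0 scale0r addr0.
exists c^-1; rewrite ahv scalerDr scalerA mulVf // scale1r opprD addrCA subrr addr0.
by rewrite -scaleNr -[_ *: h]addr0; apply: Tl.
Qed.

(** A maximal subspace [H] containing [S] but not [a] is a hyperplane complementary to the line
    through [a]; the functional is the coordinate along [a] modulo [H]. *)
Lemma separating_functional (S : set V) (a : V) : subspace S -> ~ S a ->
  exists l : {linear V -> K^o}, (forall v, S v -> l v = 0) /\ l a = 1.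
Proof.
move=> sS Sa; have [H [sH SH Ha Hex]] := maximal_subspace_avoiding sS Sa.
have Huniq v c c' : H (v - c *: a) -> H (v - c' *: a) -> c = c'.
  move=> Hc Hc'; apply/eqP; rewrite -subr_eq0; apply: contra_notT Ha => cc'.
  rewrite (_ : a = (c - c')^-1 *: (v - c' *: a) + (- (c - c')^-1) *: (v - c *: a)).
    exact: (subspace_combination _ _ sH Hc' Hc).
  rewrite scaleNr -scalerBr opprD opprK addrACA subrr add0r addrC -scalerBl.
  by rewrite scalerA mulVf // scale1r.
pose l v := sval (cid (Hex v)).
have lP v : H (v - l v *: a) := svalP (cid (Hex v)).
have l_lin : linear (l : V -> K^o).
  move=> c u v; apply: (Huniq (c *: u + v)); first exact: lP.
  rewrite scalerDl -[(c *: _ : K^o)]/(c * l u) -scalerA opprD addrACA -scalerBr.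
  by apply: sH.2.
pose lM := GRing.isLinear.Build K V K^o *:%R (l : V -> K^o) l_lin.
pose L : {linear V -> K^o} := HB.pack (l : V -> K^o) lM.
exists L; split=> [v Sv|].
  by apply: (Huniq v); [exact: lP|rewrite scale0r subr0; exact: SH].
by apply: (Huniq a); [exact: lP|rewrite scale1r subrr; exact: sH.1].
Qed.

End LinearFunctionals.

Section Artinian.
Variable K : fieldType.

Lemma artinian_minimal (A : comAlgType K) (Q : set (set A)) :
  artinian A -> (forall I, Q I -> is_ideal I) -> Q !=set0 ->
  exists2 I, Q I & forall J, Q J -> J `<=` I -> J = I.
Proof.
move=> artA Qid [I0 QI0]; apply: contrapT => nomin.
have next (I : {I | Q I}) : {J : {J | Q J} | sval J `<=` sval I & sval J <> sval I}.
  apply: cid2; case: I => I QI /=; apply: contrapT => nJ; apply: nomin.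
  exists I => // J QJ JI; apply: contrapT => nJI; apply: nJ.
  by exists (exist _ J QJ).
pose s i := iter i (fun I => s2val (next I)) (exist _ I0 QI0).
have [||N stab] := artA (fun i => sval (s i)).
- by move=> i; apply: Qid; exact: (svalP (s i)).
- by move=> i; exact: (s2valP (next (s i))).
- by apply: (s2valP' (next (s N))); exact: (stab N.+1 (leqnSn N)).
Qed.

Lemma principal_ideal (A : comAlgType K) (I : set A) (x : A) :
  is_ideal I -> is_ideal [set y | exists2 m, I m & y = x * m].
Proof.
move=> [I0 ID IM]; split; first by exists 0; rewrite ?mulr0.
- by move=> _ _ [m Im ->] [m' Im' ->]; exists (m + m'); rewrite ?mulrDr //; apply: ID.
- by move=> a _ [m Im ->]; exists (a * m); [exact: IM|rewrite mulrCA].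
Qed.

Section LocalAlgebra.
Variable B : artAlg K.

Lemma aug_alg (c : K) : aug B c%:A = c.
Proof. by rewrite linearZ /= rmorph1 -[LHS]/(c * 1) mulr1. Qed.

Lemma aug0 : aug B 0 = 0. Proof. exact: rmorph0. Qed.
Lemma aug1 : aug B 1 = 1. Proof. exact: rmorph1. Qed.
Lemma augD b b' : aug B (b + b') = aug B b + aug B b'. Proof. exact: rmorphD. Qed.
Lemma augB b b' : aug B (b - b') = aug B b - aug B b'. Proof. exact: rmorphB. Qed.
Lemma augM b b' : aug B (b * b') = aug B b * aug B b'. Proof. exact: rmorphM. Qed.

Lemma maximal_ideal : is_ideal [set b | aug B b = 0].
Proof.
split=> [|x y /= xe ye|a x /= xe]; first exact: aug0.
  by rewrite augD xe ye addr0.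
by rewrite augM xe mulr0.
Qed.

(** Nakayama's lemma for one generator: [1 - m] has residue 1, hence is invertible. *)
Lemma absorbed_eq0 (x m : B) : aug B m = 0 -> x = x * m -> x = 0.
Proof.
move=> me xm; have [y ye] : exists y, (1 - m) * y = 1.
  by apply: art_local; rewrite augB aug1 me subr0 oner_neq0.
by rewrite -[x]mulr1 -ye mulrA mulrBr mulr1 -xm subrr mul0r.
Qed.

(** The ideals generated by the powers of [b] stabilise, so some b^N is a multiple of b^(N+1), that
    is, is absorbed by an element of the maximal ideal. *)
Lemma aug_nilpotent (b : B) : aug B b = 0 -> exists N, b ^+ N = 0.
Proof.
move=> be; pose I i := [set y | exists z, y = b ^+ i * z].
have [i|i|N stab] := @art_artinian _ B I.
- split; first by exists 0; rewrite mulr0.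
    by move=> _ _ [z ->] [z' ->]; exists (z + z'); rewrite mulrDr.
  by move=> a _ [z ->]; exists (a * z); rewrite mulrCA.
- by move=> _ [z ->]; exists (b * z); rewrite exprSr mulrA.
exists N; have : I N (b ^+ N) by exists 1; rewrite mulr1.
rewrite -(stab N.+1) // => -[z zE]; apply: (@absorbed_eq0 _ (b * z)).
  by rewrite augM be mul0r.
by rewrite {1}zE exprSr mulrA.
Qed.

(* A functional on J / m J that is nonzero, which exists by Nakayama's lemma. *)
Lemma ideal_functional (J : set B) : is_ideal J -> (exists2 j, J j & j != 0) ->
  exists (l : {linear B -> K^o}) (a : B),
    [/\ J a, l a = 1 & forall b j, J j -> l (b * j) = aug B b * l j].
Proof.
move=> Jid [j0 Jj0 j00]; have [J0 JD JM] := Jid.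
(* [S] is m J, described as the intersection of all subspaces containing the products. *)
pose S := [set x | forall T : set B, subspace T ->
  (forall m j, aug B m = 0 -> J j -> T (m * j)) -> T x].
have sS : subspace S.
  split=> [T [T0 _] //|c x y Sx Sy T sT Tm].
  by apply: sT.2; [exact: Sx|exact: Sy].
have Sm m j : aug B m = 0 -> J j -> S (m * j) by move=> me Jj T sT; apply.
have [a Ja Sa] : exists2 a, J a & ~ S a.
  apply: contrapT => JS.
  have {}JS : J `<=` S.
    by move=> j Jj; apply: contrapT => Sj; apply: JS; exists j.
  (* Nakayama without finite generation of [J]. Suppose J is contained in m J, and let [L] be
     minimal among the ideals that do not annihilate [J], with x J nonzero for some [x] in [L]. Then
     x m does not annihilate [J] either, so x m = L contains [x], which forces x = 0. *)
  pose Q := [set L : set B | is_ideal L /\ exists x j, [/\ L x, J j & x * j != 0]].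
  have [||L [Lid [x [j [Lx Jj xj]]]] Lmin] := @artinian_minimal B Q (@art_artinian _ B).
  - by move=> I [].
  - exists setT; split; first by split.
    by exists 1, j0; split=> //; rewrite mul1r.
  pose L' := [set y | exists2 m, aug B m = 0 & y = x * m].
  have L'id : is_ideal L' by exact: principal_ideal maximal_ideal.
  have [_ _ LM] := Lid.
  have : L' x.
    rewrite (Lmin L') //; last by move=> _ [m _ ->]; rewrite mulrC; apply: LM.
    split=> //; apply: contrapT => L'J; move/eqP: xj; apply.
    apply: (JS j Jj [set t | x * t = 0]) => [|m i me Ji].
      split=> [|c u v /= xu xv]; first by rewrite /= mulr0.
      by rewrite mulrDr -scalerAr xu xv scaler0 addr0.
    apply: contrapT => xmi; apply: L'J; exists (x * m), i; split=> //.
      by exists m.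
    by rewrite -mulrA; apply/eqP.
  by case=> m me /(absorbed_eq0 me) x0; rewrite x0 mul0r eqxx in xj.
have [l [lS la]] := separating_functional sS Sa; exists l, a; split=> // b j Jj.
(* [b] minus its residue lies in m, so [l] kills its product with [j]. *)
rewrite -[b in LHS](subrK (aug B b : K)%:A) mulrDl raddfD /= lS ?add0r.
  by rewrite mulr_algl linearZ.
by apply: Sm => //; rewrite augB aug_alg subrr.
Qed.

End LocalAlgebra.
End Artinian.

(** * Regular functions *)

Section RegularFunctions.
Variables (K : fieldType) (n : nat) (X : set (pspace K n)).
Implicit Types (V W : opens X) (x : X).

Section Values.
Variable A : comAlgType K.

(* The value at x, or 0 outside of W. *)
Definition reval W (r : reg A W) (x : X) : A :=
  if pselect (oset W x) is left Wx then r (exist _ x (mem_set Wx)) else 0.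

Lemma reval_in W (r : reg A W) x (Wx : oset W x) :
  reval r x = r (exist _ x (mem_set Wx)).
Proof.
by rewrite /reval; case: pselect => // Wx'; congr (regfun r _); apply: val_inj.
Qed.

Lemma reval_val W (r : reg A W) (y : W) : r y = reval r (\val y).
Proof.
by rewrite (reval_in r (set_valP y)); congr (regfun r _); apply: val_inj.
Qed.

Lemma reval_ext W (r r' : reg A W) :
  (forall x, oset W x -> reval r x = reval r' x) -> r = r'.
Proof.
move=> rr'; apply: val_inj; apply/funext => y /=.
by rewrite !reval_val; apply: rr'; exact: set_valP.
Qed.

Lemma revalD W (r r' : reg A W) x : reval (r + r') x = reval r x + reval r' x.
Proof. by rewrite /reval; case: pselect => // _; rewrite addr0. Qed.

Lemma reval0 W x : reval (0 : reg A W) x = 0.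
Proof. by rewrite /reval; case: pselect. Qed.

Lemma revalB W (r r' : reg A W) x : reval (r - r') x = reval r x - reval r' x.
Proof. by rewrite /reval; case: pselect => // _; rewrite subr0. Qed.

Lemma revalM W (r r' : reg A W) x : reval (r * r') x = reval r x * reval r' x.
Proof. by rewrite /reval; case: pselect => // _; rewrite mulr0. Qed.

Lemma reval1 W x : oset W x -> reval (1 : reg A W) x = 1.
Proof. by move=> Wx; rewrite (reval_in _ Wx). Qed.

Lemma reval_regc W a x : oset W x -> reval (regc W a) x = a.
Proof. by move=> Wx; rewrite (reval_in _ Wx). Qed.

Lemma reval_sum W x I (s : seq I) (F : I -> reg A W) :
  reval (\sum_(i <- s) F i) x = \sum_(i <- s) reval (F i) x.
Proof.
by elim: s => [|i s IH]; rewrite ?big_nil ?reval0 // !big_cons revalD IH.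
Qed.

Lemma reval_res V W (h : W `<=` V) (r : reg A V) x :
  oset W x -> reval (rres h r) x = reval r x.
Proof.
move=> Wx; rewrite (reval_in _ Wx) (reval_in _ (h _ Wx)) /=.
by congr (regfun r _); apply: val_inj.
Qed.

Lemma rres_regc V W (h : W `<=` V) (a : A) : rres h (regc V a) = regc W a.
Proof. exact: val_inj. Qed.

End Values.

Section Coefficients.
Variables A C : comAlgType K.

(** Monomials take values in [K], so evaluation commutes with maps of coefficients that are only
    K-linear. This lets the functional on the ideal, which is not multiplicative, act on regular
    functions. *)
Lemma pval_map_linear (l : {linear A -> C}) (P : {mpoly A[n.+1]}) (y : pspace K n) :
  pval (map_mpoly l P) y = l (pval P y).
Proof.
have mon (D : comAlgType K) (m : 'X_{1..n.+1}) :
    pval ('X_[m] : {mpoly D[n.+1]}) y = (\prod_i hcoord y i ^+ m i)%:A.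
  rewrite /pval mevalX; have -> a : a%:A = in_alg D a by [].
  by rewrite rmorph_prod; apply: eq_bigr => i _; rewrite rmorphXn.
elim/mpolyind: P => [|c m P _ _ IH]; first by rewrite /pval !raddf0.
rewrite /pval in IH mon *; rewrite raddfD mevalD IH mevalD raddfD; congr (_ + _).
rewrite [X in X.@[_] = _](_ : _ = l c *: 'X_[m]); last first.
  apply/mpolyP => m'; rewrite [LHS]mcoeff_map_mpoly !mcoeffZ !mcoeffX.
  by case: eqP => _; rewrite ?mulr1 ?mulr0 ?raddf0.
by rewrite !mevalZ !mon !mulr_algr; apply: (esym (linearZZ l _ c)).
Qed.

Lemma dhomog_map_linear d (l : {linear A -> C}) (P : {mpoly A[n.+1]}) :
  P \is d.-homog -> map_mpoly l P \is d.-homog.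
Proof.
move=> /dhomogP hP; apply/dhomogP => m mP; apply: hP.
apply: contraTT mP; rewrite !mcoeff_msupp !negbK mcoeff_map_mpoly => /eqP ->.
by rewrite raddf0.
Qed.

Lemma regular_linear (l : {linear A -> C}) W (r : reg A W) :
  (l \o r) \in @regular_pred _ _ X C W.
Proof.
apply/asboolP => x Wx; have /asboolP/(_ x Wx) := valP r.
move=> [Z [d [P [Q [Zx hP hQ rE]]]]]; exists Z, d, (map_mpoly l P), Q.
split=> //; first exact: dhomog_map_linear.
by move=> y /rE[Qy ry]; split=> //; rewrite pval_map_linear -linearZZ -ry.
Qed.

Definition lmap (l : {linear A -> C}) W (r : reg A W) : reg C W :=
  Reg (regular_linear l r).

Lemma reval_lmap (l : {linear A -> C}) W (r : reg A W) x :
  reval (lmap l r) x = l (reval r x).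
Proof. by rewrite /reval; case: pselect => // _; rewrite raddf0. Qed.

Lemma reval_rmap (f : {lrmorphism A -> C}) W (r : reg A W) x :
  reval (rmap f r) x = f (reval r x).
Proof. by rewrite /reval; case: pselect => // _; rewrite raddf0. Qed.

Lemma rmap_res (f : {lrmorphism A -> C}) V W (h : W `<=` V) (r : reg A V) :
  rmap f (rres h r) = rres h (rmap f r).
Proof. exact: val_inj. Qed.

End Coefficients.

Lemma regular_fraction (A : comAlgType K) (W : opens X) d
    (P : {mpoly A[n.+1]}) (Q : {mpoly K[n.+1]}) :
  P \is d.-homog -> Q \is d.-homog ->
  (forall x, oset W x -> kval Q (\val x) != 0) ->
  (fun y : W => (kval Q (\val (\val y)))^-1 *: pval P (\val (\val y)))
    \in @regular_pred _ _ X A W.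
Proof.
move=> hP hQ Q0; apply/asboolP => x Wx; exists W, d, P, Q; split=> // y Wy.
by split=> //; apply: Q0.
Qed.

Definition fraction (A : comAlgType K) (W : opens X) d
    (P : {mpoly A[n.+1]}) (Q : {mpoly K[n.+1]}) (hP : P \is d.-homog)
    (hQ : Q \is d.-homog) (Q0 : forall x, oset W x -> kval Q (\val x) != 0) :
  reg A W := Reg (regular_fraction hP hQ Q0).

Lemma reval_fraction (A : comAlgType K) (W : opens X) d
    (P : {mpoly A[n.+1]}) (Q : {mpoly K[n.+1]}) (hP : P \is d.-homog)
    (hQ : Q \is d.-homog) (Q0 : forall x, oset W x -> kval Q (\val x) != 0) x :
  oset W x -> reval (fraction hP hQ Q0) x = (kval Q (\val x))^-1 *: pval P (\val x).
Proof. by move=> Wx; rewrite (reval_in _ Wx). Qed.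

Lemma reg_fraction (A : comAlgType K) W (r : reg A W) x : oset W x ->
  exists (Z : opens X) d (P : {mpoly A[n.+1]}) (Q : {mpoly K[n.+1]}),
    [/\ oset Z x, Z `<=` W, P \is d.-homog, Q \is d.-homog &
      forall y, oset Z y -> kval Q (\val y) != 0 /\
        reval r y = (kval Q (\val y))^-1 *: pval P (\val y)].
Proof.
move=> Wx; have /asboolP/(_ x Wx) := valP r.
move=> [Z [d [P [Q [Zx hP hQ rE]]]]]; exists (ocap Z W), d, P, Q.
split=> //; first by move=> y [].
by move=> y [Zy Wy]; rewrite (reval_in _ Wy); exact: (rE (exist _ y (mem_set Wy))).
Qed.

Lemma reg_local_lift (A B : comAlgType K) (f : {lrmorphism B -> A}) W
    (r : reg A W) x : (forall a, exists b, f b = a) -> oset W x ->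
  exists (Z : opens X) (h : Z `<=` W) (t : reg B Z),
    oset Z x /\ rmap f t = rres h r.
Proof.
move=> fs Wx; have [Z [d [P [Q [Zx ZW hP hQ rE]]]]] := reg_fraction r Wx.
pose g a := sval (cid (fs a)).
have gK a : f (g a) = a := svalP (cid (fs a)).
(* Denominators have coefficients in [K], so only the numerator is lifted. The sum runs over the
   support of [P] because [g 0] may be nonzero and would spoil homogeneity. *)
pose P' : {mpoly B[n.+1]} := \sum_(m <- msupp P) g P@_m *: 'X_[m].
have hP' : P' \is d.-homog.
  rewrite /P' big_seq; apply: rpred_sum => m mP; apply: rpredZ.
  by rewrite dhomogX; move/dhomogP: hP => /(_ _ mP) /eqP.
have P'P : map_mpoly f P' = P.
  rewrite /P' raddf_sum [RHS]mpolyE; apply: eq_bigr => m _ /=.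
  by rewrite [LHS]map_mpolyZ map_mpolyX; congr (_ *: _); exact: gK.
have Q0 y (Zy : oset Z y) : kval Q (\val y) != 0 := (rE y Zy).1.
exists Z, ZW, (fraction hP' hQ Q0); split=> //; apply: reval_ext => y Zy.
rewrite reval_rmap reval_fraction // reval_res // (rE y Zy).2.
by rewrite linearZ /= -pval_map P'P.
Qed.

Lemma nilpotentD (R : comNzRingType) (a b : R) :
  (exists N, a ^+ N = 0) -> (exists N, b ^+ N = 0) -> exists N, (a + b) ^+ N = 0.
Proof.
move=> [i ai] [j bj]; exists (i + j)%N; rewrite exprDn big1 // => k _.
have [ki|ik] := leqP i (i + j - k).
  by rewrite -(subnK ki) exprD ai mulr0 mul0r mul0rn.
have jk : (j <= k)%N by rewrite leqNgt; apply: contraL ik => kj;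
  rewrite -leqNgt -addnBA ?leq_addr // ltnW.
by rewrite -(subnK jk) exprD bj !mulr0 mul0rn.
Qed.

(** * Local invertibility of regular functions with nonzero residue *)

Section Units.
Variables (A : comAlgType K) (e : {lrmorphism A -> (K^o : comAlgType K)}).
Hypothesis e_nil : forall a, e a = 0 -> exists N, a ^+ N = 0.

Lemma mpoly_nilpotent (P : {mpoly A[n.+1]}) :
  (forall m, e P@_m = 0) -> exists N, P ^+ N = 0.
Proof.
move=> eP; rewrite (mpolyE P); elim: (msupp P : seq _) => [|m s IH].
  by exists 1%N; rewrite big_nil expr1.
rewrite big_cons; apply: nilpotentD => //.
have [N aN] := e_nil (eP m); exists N.
by rewrite exprZn aN scale0r.
Qed.

(** The difficulty is that the inverse of P / Q must again have a denominator over [K]. If [P0] is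
    the reduction of [P], then P0 - P is nilpotent, hence [P] divides a power of [P0]: from P S =
    P0^(N+1) the inverse is Q S / P0^(N+1), defined where [P0] does not vanish. *)
Lemma reg_local_inverse W (r : reg A W) x : oset W x -> e (reval r x) != 0 ->
  exists (Z : opens X) (h : Z `<=` W) (t : reg A Z),
    oset Z x /\ t * rres h r = 1.
Proof.
move=> Wx rx; have [Z [d [P [Q [Zx ZW hP hQ rE]]]]] := reg_fraction r Wx.
pose P0 : {mpoly K[n.+1]} := map_mpoly e P.
have hP0 : P0 \is d.-homog by exact: (dhomog_map e hP).
pose P0A := map_mpoly (in_alg A) P0.
have hP0A : P0A \is d.-homog by exact: dhomog_map.
have [N NP] : exists N, (P0A - P) ^+ N = 0.
  apply: mpoly_nilpotent => m; rewrite mcoeffB !mcoeff_map_mpoly rmorphB /=.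
  by rewrite linearZ /= rmorph1 -[_ *: 1]/(_ * 1) mulr1 subrr.
have P0x (y : pspace K n) : kval P0 y = e (pval P y).
  rewrite -(pval_map e) /pval /kval; apply: meval_eq => i.
  by rewrite -[LHS]mulr1.
(* The cofactor in the factorisation of u^(N+1) - v^(N+1) by u - v, with u = P0 and v = P0 - P, so
   that u - v = P and v^(N+1) = 0. *)
pose S := \sum_(i < N.+1) P0A ^+ (N - i) * (P0A - P) ^+ i.
have PS : P * S = P0A ^+ N.+1.
  have := subrXX P0A (P0A - P) N.+1.
  by rewrite [(P0A - P) ^+ N.+1]exprS NP mulr0 subr0 opprB addrCA subrr addr0 => ->.
have hS : S \is (d * N).-homog.
  apply: rpred_sum => i _; rewrite -[N in (d * N)%N](subnK (leq_ord i)) mulnDr.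
  by apply: dhomogM; apply: dhomogMn => //; exact: rpredB.
have hQS : map_mpoly (in_alg A) Q * S \is (d * N.+1).-homog.
  by rewrite mulnS; apply: dhomogM => //; exact: dhomog_map.
have oD : zopen [set y : X | ~ zero_locus [set P0] (\val y)].
  by exists [set P0] => // _ ->; exists d.
pose Z' := ocap Z (Opens oD).
have P0y y : oset Z' y -> kval P0 (\val y) != 0.
  by case=> _ /= P0y; apply: contra_notN P0y => /eqP P0y _ ->.
have P0Ny y : oset Z' y -> kval (P0 ^+ N.+1) (\val y) != 0.
  by move=> /P0y P0y0; rewrite /kval rmorphXn; exact: expf_neq0.
have Z'W : Z' `<=` W by move=> y [/ZW].
exists Z', Z'W, (fraction hQS (dhomogMn N.+1 hP0) P0Ny); split.
  split=> //= /(_ P0 erefl); rewrite P0x; move: rx.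
  rewrite (rE x Zx).2 linearZ /= => + P0x0; rewrite P0x0.
  by rewrite scaler0 eqxx.
apply: reval_ext => y Z'y; rewrite revalM reval1 // reval_res // reval_fraction //.
have [Qy ->] := rE y Z'y.1.
have Q1 : kval P0 (\val y) ^+ N.+1 != 0 by rewrite expf_neq0 // P0y.
have pvM (P1 P2 : {mpoly A[n.+1]}) z : pval (P1 * P2) z = pval P1 z * pval P2 z.
  by rewrite /pval mevalM.
rewrite pvM pval_const mulr_algl -!scalerAl -scalerAr !scalerA mulfK //.
rewrite mulrC -pvM PS -[P0A ^+ _]rmorphXn pval_const scalerA mulVf ?scale1r //.
exact: P0Ny.
Qed.

End Units.
End RegularFunctions.

(** * Frames, and the sheaf of all functions *)

Section Modules.
Variables (K : fieldType) (n : nat) (X : set (pspace K n)).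
Implicit Types (V W Z : opens X) (x : X).

Lemma ocapl V W : ocap V W `<=` V. Proof. by move=> x []. Qed.
Lemma ocapr V W : ocap V W `<=` W. Proof. by move=> x []. Qed.

Section Restrictions.
Variables (A : comAlgType K) (F : pmod X A).

Lemma pres_irr V W (h h' : W `<=` V) (s : psec F V) : pres h s = pres h' s.
Proof. by rewrite (Prop_irrelevance h h'). Qed.

Lemma presN V W (h : W `<=` V) (s : psec F V) : pres h (- s) = - pres h s.
Proof. by rewrite -scaleN1r pres_scale rmorphN1 scaleN1r. Qed.

Lemma presB V W (h : W `<=` V) (s t : psec F V) :
  pres h (s - t) = pres h s - pres h t.
Proof. by rewrite pres_add presN. Qed.

Lemma pres_sum V W (h : W `<=` V) I (l : seq I) (s : I -> psec F V) :
  pres h (\sum_(i <- l) s i) = \sum_(i <- l) pres h (s i).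
Proof. by elim: l => [|i l IH]; rewrite ?big_nil ?pres0 // !big_cons pres_add IH. Qed.

End Restrictions.

Section SemilinearMaps.
Variables (A B : comAlgType K) (f : {lrmorphism A -> B}).
Variables (E : pmod X A) (F : pmod X B) (p : smor f E F).

Lemma rmap1 V : rmap f (1 : reg A V) = 1.
Proof. by apply: val_inj; apply/funext => y; exact: rmorph1. Qed.

Lemma smapD V (s t : psec E V) : p V (s + t) = p V s + p V t.
Proof. by rewrite -[s in LHS]scale1r smap_linear rmap1 scale1r. Qed.

Lemma smap0 V : p V 0 = 0.
Proof. by apply: (addIr (p V 0)); rewrite -smapD !add0r. Qed.

Lemma smapZ V r (s : psec E V) : p V (r *: s) = rmap f r *: p V s.
Proof. by rewrite -[r *: s]addr0 smap_linear smap0 addr0. Qed.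

Lemma smapN V (s : psec E V) : p V (- s) = - p V s.
Proof. by apply: (addIr (p V s)); rewrite -smapD !addNr smap0. Qed.

Lemma smapB V (s t : psec E V) : p V (s - t) = p V s - p V t.
Proof. by rewrite smapD smapN. Qed.

Lemma smap_sum V I (l : seq I) (s : I -> psec E V) :
  p V (\sum_(i <- l) s i) = \sum_(i <- l) p V (s i).
Proof. by elim: l => [|i l IH]; rewrite ?big_nil ?smap0 // !big_cons smapD IH. Qed.

End SemilinearMaps.

Definition lincomb (A : comAlgType K) (F : pmod X A) V m (e : 'I_m -> psec F V)
    W (h : W `<=` V) (r : 'I_m -> reg A W) : psec F W :=
  \sum_i r i *: pres h (e i).

Lemma lincomb_res (A : comAlgType K) (F : pmod X A) V m (e : 'I_m -> psec F V)
    W Z (h : W `<=` V) (h' : Z `<=` W) (h'' : Z `<=` V) (r : 'I_m -> reg A W) :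
  pres h' (lincomb e h r) = lincomb e h'' (fun i => rres h' (r i)).
Proof.
rewrite /lincomb pres_sum; apply: eq_bigr => i _.
by rewrite pres_scale (pres_comp _ _ h'').
Qed.

Lemma lincomb_comp (A : comAlgType K) (F : pmod X A) V W Z m m'
    (e : 'I_m -> psec F V) (e' : 'I_m' -> psec F W) (h : W `<=` V)
    (g : 'I_m' -> 'I_m -> reg A W) (hZ : Z `<=` W) (hZ' : Z `<=` V)
    (r : 'I_m' -> reg A Z) :
  (forall j, e' j = lincomb e h (g j)) ->
  lincomb e' hZ r = lincomb e hZ' (fun i => \sum_j r j * rres hZ (g j i)).
Proof.
move=> e'E; rewrite /lincomb.
under eq_bigr => j _ do rewrite e'E (lincomb_res _ _ _ hZ') scaler_sumr.
rewrite exchange_big /=; apply: eq_bigr => i _; rewrite scaler_suml.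
by apply: eq_bigr => j _; rewrite scalerA.
Qed.

Lemma smap_lincomb (A B : comAlgType K) (f : {lrmorphism A -> B})
    (E : pmod X A) (F : pmod X B) (p : smor f E F) V m (e : 'I_m -> psec E V)
    W (h : W `<=` V) (r : 'I_m -> reg A W) :
  p W (lincomb e h r) = lincomb (fun i => p V (e i)) h (fun i => rmap f (r i)).
Proof.
by rewrite /lincomb smap_sum; apply: eq_bigr => i _; rewrite smapZ smap_res.
Qed.

Section Frames.
Variables (A : comAlgType K) (F : pmod X A) (V : opens X) (m : nat).
Variables (e : 'I_m -> psec F V) (he : is_frame e).

Definition fcoord W (h : W `<=` V) (s : psec F W) : 'I_m -> reg A W :=
  sval (cid (he h s)).

Lemma fcoordK W (h : W `<=` V) (s : psec F W) : lincomb e h (fcoord h s) = s.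
Proof. by have [/esym] := svalP (cid (he h s)). Qed.

Lemma lincombK W (h : W `<=` V) (r : 'I_m -> reg A W) : fcoord h (lincomb e h r) = r.
Proof. by have [_] := svalP (cid (he h (lincomb e h r))); apply. Qed.

Lemma fcoord_linear W (h : W `<=` V) r (s t : psec F W) i :
  fcoord h (r *: s + t) i = r * fcoord h s i + fcoord h t i.
Proof.
rewrite -{1}[s](fcoordK h) -{1}[t](fcoordK h).
rewrite (_ : _ + _ = lincomb e h (fun i => r * fcoord h s i + fcoord h t i)).
  by rewrite lincombK.
rewrite /lincomb scaler_sumr -big_split; apply: eq_bigr => j _ /=.
by rewrite scalerA scalerDl.
Qed.

Lemma fcoordD W (h : W `<=` V) (s t : psec F W) i :
  fcoord h (s + t) i = fcoord h s i + fcoord h t i.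
Proof. by rewrite -[s in LHS]scale1r fcoord_linear mul1r. Qed.

Lemma fcoord0 W (h : W `<=` V) i : fcoord h 0 i = 0.
Proof. by apply: (addIr (fcoord h 0 i)); rewrite -fcoordD !add0r. Qed.

Lemma fcoordZ W (h : W `<=` V) r (s : psec F W) i :
  fcoord h (r *: s) i = r * fcoord h s i.
Proof. by rewrite -[r *: s]addr0 fcoord_linear fcoord0 addr0. Qed.

Lemma fcoord_res W Z (h : W `<=` V) (h' : Z `<=` W) (h'' : Z `<=` V)
    (s : psec F W) i : fcoord h'' (pres h' s) i = rres h' (fcoord h s i).
Proof. by rewrite -{1}[s](fcoordK h) (lincomb_res _ _ _ h'') lincombK. Qed.

Lemma lincomb_delta W (h : W `<=` V) i :
  lincomb e h (fun j => (i == j)%:R) = pres h (e i).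
Proof.
rewrite /lincomb (bigD1 i) //= eqxx scale1r big1 ?addr0 // => j /negPf ji.
by rewrite eq_sym ji scale0r.
Qed.

Lemma fcoord_frame W (h : W `<=` V) i j : fcoord h (pres h (e i)) j = (i == j)%:R.
Proof. by rewrite -lincomb_delta lincombK. Qed.

Lemma frame_res W (h : W `<=` V) : is_frame (fun i => pres h (e i)).
Proof.
move=> Z hZ s; have hZV := subset_trans hZ h.
have [r [-> runiq]] := he hZV s; exists r; split.
  by apply: eq_bigr => i _; rewrite (pres_comp _ _ hZV).
move=> r' r'E; apply: runiq; rewrite r'E.
by apply: eq_bigr => i _; rewrite (pres_comp _ _ hZV).
Qed.

(* Coordinates of the germ of s at x. *)
Definition gcoord x W (s : psec F W) i : A :=
  reval (fcoord (@ocapr W V) (pres (@ocapl W V) s) i) x.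

Section Germs.
Variables (x : X) (Vx : oset V x).

Lemma gcoord_linear W r (s t : psec F W) i : oset W x ->
  gcoord x (r *: s + t) i = reval r x * gcoord x s i + gcoord x t i.
Proof.
move=> Wx; rewrite /gcoord pres_add pres_scale fcoord_linear revalD revalM.
by rewrite reval_res.
Qed.

Lemma gcoord_res W Z (h : Z `<=` W) (s : psec F W) i : oset Z x ->
  gcoord x (pres h s) i = gcoord x s i.
Proof.
move=> Zx; have h' : ocap Z V `<=` ocap W V by move=> y [/h].
rewrite /gcoord (pres_comp _ _ (subset_trans h' (@ocapl W V))).
by rewrite -(pres_comp (@ocapl W V) h') (fcoord_res (@ocapr W V)) reval_res.
Qed.

Lemma gcoord_in W (h : W `<=` V) (s : psec F W) i : oset W x ->
  gcoord x s i = reval (fcoord h s i) x.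
Proof. by move=> Wx; rewrite /gcoord (fcoord_res h) reval_res. Qed.

End Germs.
End Frames.

(* Test sheaf for the universal property of base change: all C-valued functions,
   with O_X (x) A acting through e. *)
Section FunctionSheaf.
Variables (A C : comAlgType K) (e : {lrmorphism A -> C}).

Definition fsec W : Type := W -> C.

Section FunctionModule.
Variable W : opens X.
HB.instance Definition _ := GRing.Zmodule.copy (fsec W) (W -> C).

Definition fscale (r : reg A W) (s : fsec W) : fsec W := fun y => e (r y) * s y.

Lemma fscaleA r r' s : fscale r (fscale r' s) = fscale (r * r') s.
Proof. by apply/funext => y; rewrite /fscale mulrA -rmorphM. Qed.
Lemma fscale1 : left_id 1 fscale.
Proof. by move=> s; apply/funext => y; rewrite /fscale rmorph1 mul1r. Qed.
Lemma fscaleDr : right_distributive fscale +%R.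
Proof. by move=> r s t; apply/funext => y; rewrite /fscale mulrDr. Qed.
Lemma fscaleDl (s : fsec W) : {morph fscale^~ s : r r' / r + r'}.
Proof. by move=> r r'; apply/funext => y; rewrite /fscale rmorphD mulrDl. Qed.
HB.instance Definition _ := GRing.Zmodule_isLmodule.Build (reg A W) (fsec W)
  fscaleA fscale1 fscaleDr fscaleDl.

End FunctionModule.

Definition fres V W (h : W `<=` V) (s : fsec V) : fsec W := s \o Defs.incl h.

Lemma fres_linear V W (h : W `<=` V) r (s t : fsec V) :
  fres h (r *: s + t) = rres h r *: fres h s + fres h t.
Proof. exact/funext. Qed.

Lemma fres_id V (h : V `<=` V) (s : fsec V) : fres h s = s.
Proof. by apply/funext => y; congr (s _); apply: val_inj. Qed.

Lemma fres_comp V W Z (h : W `<=` V) (h' : Z `<=` W) (h'' : Z `<=` V)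
  (s : fsec V) : fres h' (fres h s) = fres h'' s.
Proof. by apply/funext => y; congr (s _); apply: val_inj. Qed.

Definition fun_pmod : pmod X A := @PMod _ _ _ A fsec fres fres_linear fres_id fres_comp.

Lemma fun_is_sheaf : is_sheaf fun_pmod.
Proof.
move=> V I W h cv s compat.
have cv' (y : V) : exists i, oset (W i) (\val y) by apply: cv; exact: set_valP.
pose i y := sval (cid (cv' y)).
have ip y : oset (W (i y)) (\val y) by exact: svalP (cid (cv' y)).
pose t : psec fun_pmod V := fun y => (s (i y) : fsec _) (exist _ (\val y) (mem_set (ip y))).
have st j k (y : W j) (z : W k) : \val y = \val z ->
    (s j : fsec _) y = (s k : fsec _) z.
  move=> yz; have yjk : oset (ocap (W j) (W k)) (\val y).
    by split; [exact: set_valP|rewrite yz; exact: set_valP].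
  have := congr1 (fun u : fsec _ => u (exist _ (\val y) (mem_set yjk)))
    (compat j k (@ocapl _ _) (@ocapr _ _)).
  rewrite /= /fres /= => jk.
  transitivity ((s j : fsec _) (Defs.incl (@ocapl (W j) (W k)) (exist _ (\val y) (mem_set yjk)))).
    by congr ((s j : fsec _) _); apply: val_inj.
  by rewrite [LHS]jk; congr ((s k : fsec _) _); apply: val_inj.
exists t; split=> [j|t' t'E]; apply/funext => y; first exact: st.
rewrite /t -(t'E (i y)) /= /fres /=; congr ((t' : fsec _) _); exact: val_inj.
Qed.

End FunctionSheaf.

Section PointEvaluation.
Variables (A B C : comAlgType K) (g : {lrmorphism B -> A}) (e : {lrmorphism A -> C}).
Variables (F : pmod X B) (V : opens X) (m : nat) (b : 'I_m -> psec F V).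
Variables (hb : is_frame b) (x : X) (Vx : oset V x) (w : 'I_m -> C).

(** Sections of the target are arbitrary functions, so extension by 0 outside [x] is allowed, and
    any weights [w] on the coordinates at [x] give a morphism of sheaves. *)
Definition evalmap W (s : psec F W) : psec (fun_pmod e) W := fun y : W =>
  if pselect (\val y = x) then \sum_i e (g (gcoord hb x s i)) * w i else 0.

Lemma evalmap_linear W r (s t : psec F W) :
  evalmap (r *: s + t) = rmap g r *: evalmap s + evalmap t.
Proof.
apply/funext => y; rewrite -[RHS]/(e (rmap g r y) * evalmap s y + evalmap t y).
rewrite /evalmap; case: pselect => yx; last by rewrite mulr0 addr0.
have Wx : oset W x by rewrite -yx; exact: set_valP.
rewrite mulr_sumr -big_split; apply: eq_bigr => i _ /=.
rewrite gcoord_linear // !rmorphD !rmorphM mulrDl mulrA; congr (_ * _ * _ + _).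
by rewrite -yx -reval_val.
Qed.

Lemma evalmap_res W Z (h : Z `<=` W) (s : psec F W) :
  evalmap (pres h s) = pres h (evalmap s).
Proof.
apply/funext => y; rewrite -[RHS]/(evalmap s (Defs.incl h y)) /evalmap /=.
case: pselect => yx //; have Zx : oset Z x by rewrite -yx; exact: set_valP.
by apply: eq_bigr => i _; rewrite gcoord_res.
Qed.

Definition evalmor : smor g F (fun_pmod e) := SMor evalmap_linear evalmap_res.

Lemma evalmorE W (s : psec F W) (y : W) : \val y = x ->
  (evalmor W s : fsec C W) y = \sum_i e (g (gcoord hb x s i)) * w i.
Proof. by move=> yx; rewrite /= /evalmap; case: pselect. Qed.

Lemma evalmorN W (s : psec F W) (y : W) : \val y <> x ->
  (evalmor W s : fsec C W) y = 0.
Proof. by move=> yx; rewrite /= /evalmap; case: pselect. Qed.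

End PointEvaluation.
End Modules.

(** * Base change of a locally free sheaf *)

Section BaseChange.
Variables (K : fieldType) (n : nat) (X : set (pspace K n)).
Implicit Types (V W Z : opens X) (x : X).

Lemma gcoord_frame (A : comAlgType K) (F : pmod X A) V m (e : 'I_m -> psec F V)
    (he : is_frame e) x i j : oset V x -> gcoord he x (e i) j = (i == j)%:R.
Proof.
move=> Vx; rewrite (gcoord_in he Vx (@subset_refl _ _)) //.
rewrite -[e i](pres_id (@subset_refl _ _)) fcoord_frame.
by case: (i == j); [exact: reval1|exact: reval0].
Qed.

Lemma fun_lincomb (A C : comAlgType K) (eps : {lrmorphism A -> C}) V m
    (b : 'I_m -> psec (fun_pmod X eps) V) W (h : W `<=` V)
    (r : 'I_m -> reg A W) (y : W) :
  (lincomb b h r : fsec C W) y =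
  \sum_i eps (r i y) * (b i : fsec C V) (Defs.incl h y).
Proof.
rewrite /lincomb; elim: (index_enum _) => [|i l IH]; first by rewrite !big_nil.
by rewrite !big_cons -IH.
Qed.

Section Independence.
Variables (A B : comAlgType K) (f : {lrmorphism B -> A}).
Variables (E : pmod X B) (F : pmod X A) (p : smor f E F) (bc : is_base_change p).
Variables (V : opens X) (m : nat) (e : 'I_m -> psec E V) (he : is_frame e).

(** The [i]-th coordinate at a point [x] is a morphism from [E] to the sheaf of functions, so it
    extends along [p]. Applied to the relation, the extension returns the value of [r i] at [x]. *)
Lemma base_change_independent W (h : W `<=` V) (r : 'I_m -> reg A W) :
  lincomb (fun i => p V (e i)) h r = 0 -> forall i, r i = 0.
Proof.
move=> r0 i; apply: reval_ext => x Wx; rewrite reval0.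
pose idA : {lrmorphism A -> A} := idfun.
pose q := evalmor f idA he (h _ Wx) (fun j => (j == i)%:R).
have [u uE _] := bc (@fun_is_sheaf _ _ _ _ _ idA) q.
pose y : W := exist _ x (mem_set Wx).
have := congr1 (fun s => (u W s : fsec A W) y) r0.
rewrite smap0 smap_lincomb fun_lincomb -[RHS]/0 => <-.
rewrite (bigD1 i) //= big1 => [|j ji].
  rewrite uE evalmorE // (bigD1 i) //= big1 => [|k /negPf ki].
    rewrite gcoord_frame ?eqxx; last exact: (h x Wx).
    by rewrite !addr0 /= rmorph1 !mulr1 reval_val.
  by rewrite ki mulr0.
rewrite uE evalmorE // big1 ?mulr0 // => k _.
rewrite gcoord_frame; last exact: (h x Wx).
have [->|] := eqVneq k i; last by rewrite mulr0.
by rewrite (negPf ji) /= !rmorph0 mul0r.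
Qed.

End Independence.

Section Residue.
Variables (A : comAlgType K) (eps : {lrmorphism A -> (K^o : comAlgType K)}).
Variables (W : opens X) (x : X) (Wx : oset W x).

Definition residue_at (r : reg A W) : K := eps (reval r x).
Lemma residue_at_zmod : zmod_morphism residue_at.
Proof. by move=> r r'; rewrite /residue_at revalB; exact: rmorphB. Qed.
Lemma residue_at_monoid : monoid_morphism residue_at.
Proof.
split=> [|r r']; rewrite /residue_at; first by rewrite reval1 //; exact: rmorph1.
by rewrite revalM; exact: rmorphM.
Qed.

Definition residue_morphism : {rmorphism reg A W -> K} :=
  HB.pack residue_at
    (GRing.isZmodMorphism.Build (reg A W) K residue_at residue_at_zmod)
    (GRing.isMonoidMorphism.Build (reg A W) K residue_at residue_at_monoid).

End Residue.

Lemma left_inverse_exists m m' (G : 'M[K]_(m, m')) :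
  (forall v : 'I_m' -> K, (forall i, \sum_j G i j * v j = 0) -> forall j, v j = 0) ->
  exists c : 'M[K]_(m', m), c *m G = 1%:M.
Proof.
move=> Gker; have /row_freeP[c GTc] : row_free G^T.
  rewrite -kermx_eq0; apply/rowV0P => v /sub_kermxP vG.
  apply/rowP => j; rewrite mxE; apply: Gker => i.
  have := congr1 (fun M : 'rV_m => M 0 i) vG; rewrite !mxE => vGi; rewrite -[RHS]vGi.
  by apply: eq_bigr => k _; rewrite !mxE mulrC.
by exists c^T; rewrite -[RHS]trmx1 -GTc trmx_mul trmxK.
Qed.

Section Generation.
Variables (A B : comAlgType K) (f : {lrmorphism B -> A}).
Variables (eps : {lrmorphism A -> (K^o : comAlgType K)}).
Hypothesis eps_nil : forall a, eps a = 0 -> exists N, a ^+ N = 0.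
Variables (E : pmod X B) (F : pmod X A) (p : smor f E F) (bc : is_base_change p).
Variables (V : opens X) (m m' : nat) (e : 'I_m -> psec E V) (he : is_frame e).
Variables (e' : 'I_m' -> psec F V) (he' : is_frame e').

Let g i := fcoord he' (@subset_refl _ _) (p V (e i)).

Lemma frame_image i : p V (e i) = lincomb e' (@subset_refl _ _) (g i).
Proof. by rewrite fcoordK. Qed.

Lemma gcoord_smap x W (s : psec E W) j : oset V x -> oset W x ->
  gcoord he' x (p W s) j = \sum_i f (gcoord he x s i) * reval (g i j) x.
Proof.
move=> Vx Wx; rewrite {1}/gcoord -smap_res.
rewrite -[pres _ s](fcoordK he (@ocapr _ _ _ W V)) smap_lincomb.
rewrite (lincomb_comp (@ocapr _ _ _ W V) (@ocapr _ _ _ W V) _ frame_image).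
rewrite lincombK reval_sum; apply: eq_bigr => i _.
by rewrite revalM reval_rmap reval_res.
Qed.

(* A relation v gives a morphism F -> K supported at x that kills p, hence is 0
   by uniqueness in the universal property. *)
Lemma residue_kernel x (v : 'I_m' -> K) : oset V x ->
  (forall i, \sum_j (eps (reval (g i j) x) : K) * v j = 0) -> forall j, v j = 0.
Proof.
move=> Vx gv j.
pose ev (w : 'I_m' -> K^o) := evalmor (idfun : {lrmorphism A -> A}) eps he' Vx w.
pose q := evalmor f eps he Vx (fun=> 0).
have [u _ uuniq] := bc (@fun_is_sheaf _ _ _ _ _ eps) q.
have evq (w : 'I_m' -> K^o) :
    (forall i, \sum_j (eps (reval (g i j) x)) * w j = 0) ->
    forall W (s : psec E W), ev w W (p W s) = q W s.
  move=> gw W s; apply/funext => y.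
  have [yx|yx] := pselect (\val y = x); last by rewrite !evalmorN.
  have Wx : oset W x by rewrite -yx; exact: set_valP.
  rewrite !evalmorE // [RHS]big1 => [|i _]; last by rewrite mulr0.
  under eq_bigr => i _ do rewrite gcoord_smap // rmorph_sum /= mulr_suml.
  rewrite exchange_big big1 //= => i _.
  rewrite -[RHS](mulr0 (eps (f (gcoord he x s i)))) -[in RHS](gw i) mulr_sumr.
  by apply: eq_bigr => k _; rewrite rmorphM mulrA.
pose y : V := exist _ x (mem_set Vx).
have ej w : (ev w V (e' j) : fsec (K^o : comAlgType K) V) y = w j.
  rewrite evalmorE // (bigD1 j) //= big1 => [|k /negPf kj].
    by rewrite gcoord_frame // eqxx !rmorph1 mul1r addr0.
  by rewrite gcoord_frame // eq_sym kj !rmorph0 mul0r.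
rewrite -(ej v) (uuniq (ev v)); last exact: evq.
rewrite -(uuniq (ev (fun=> 0))) ?ej //; apply: evq => i.
by rewrite big1 // => k _; rewrite mulr0.
Qed.

(** The sizes [m] and [m'] are not known to agree, so the matrix of the images in the frame [e'] has
    no determinant to invert. Its residue at [x] is injective and has a left inverse [c] over [K];
    viewed as a constant matrix, [c] times the original matrix has a determinant invertible near
    [x], and the adjugate yields a left inverse there. *)
Lemma base_change_generates x : oset V x ->
  exists (Z : opens X) (hZ : Z `<=` V), oset Z x /\
    forall W (h : W `<=` Z) (h' : W `<=` V) (s : psec F W),
      exists r : 'I_m -> reg A W, s = lincomb (fun i => p V (e i)) h' r.
Proof.
move=> Vx; pose rho := residue_morphism eps Vx.
pose gm : 'M[reg A V]_(m, m') := \matrix_(i, j) g i j.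
have [c cG] : exists c : 'M[K]_(m', m), c *m map_mx rho gm = 1%:M.
  apply: left_inverse_exists => v gv; apply: (residue_kernel Vx) => i.
  rewrite -[RHS](gv i); apply: eq_bigr => j _; rewrite !mxE; reflexivity.
pose cm : 'M[reg A V]_(m', m) := map_mx (fun a => regc V a%:A) c.
have rho_c : map_mx rho cm = c.
  apply/matrixP => i j; rewrite !mxE /= /residue_at reval_regc // linearZ /=.
  by rewrite rmorph1; exact: mulr1.
have [|Z [hZ [t [Zx tdet]]]] := @reg_local_inverse _ _ _ _ eps eps_nil _ (\det (cm *m gm)) _ Vx.
  rewrite -[X in X != 0]/(rho (\det (cm *m gm))) -det_map_mx map_mxM rho_c cG det1.
  exact: oner_neq0.
exists Z, hZ; split=> // W h h' s.
pose q := t *: \adj (map_mx (rres hZ) (cm *m gm)) *m map_mx (rres hZ) cm.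
have qg : q *m map_mx (rres hZ) gm = 1%:M.
  rewrite /q -mulmxA -map_mxM -scalemxAl mul_adj_mx det_map_mx.
  by rewrite scale_scalar_mx tdet.
have e'E j : pres hZ (e' j) = lincomb (fun i => p V (e i)) hZ (q j).
  rewrite (lincomb_comp hZ hZ _ frame_image).
  rewrite -lincomb_delta; congr lincomb; apply/funext => l.
  have := congr1 (fun M : 'M_m' => M j l) qg; rewrite !mxE => <-.
  by apply: eq_bigr => i _; rewrite !mxE.
exists (fun i => \sum_j fcoord he' h' s j * rres h (q j i)).
rewrite -(lincomb_comp h h' _ e'E) -{1}[s](fcoordK he' h').
by apply: eq_bigr => j _; rewrite (pres_comp _ _ h').
Qed.

End Generation.

Section LocalLifting.
Variables (A B : comAlgType K) (f : {lrmorphism B -> A}).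
Hypothesis f_surj : forall a, exists b, f b = a.
Variables (eps : {lrmorphism A -> (K^o : comAlgType K)}).
Hypothesis eps_nil : forall a, eps a = 0 -> exists N, a ^+ N = 0.
Variables (E : pmod X B) (F : pmod X A) (p : smor f E F) (bc : is_base_change p).
Hypotheses (E_free : locally_free E) (F_free : locally_free F).

(** Near [x] the section is a combination of images of a frame of [E]; its finitely many
    coefficients lift on a common neighbourhood. *)
Lemma base_change_local_lift W (s : psec F W) x : oset W x ->
  exists (Z : opens X) (h : Z `<=` W) (t : psec E Z),
    oset Z x /\ p Z t = pres h s.
Proof.
move=> Wx; have [V1 [m [e [V1x he]]]] := E_free x.
have [V2 [m' [e' [V2x he']]]] := F_free x.
pose V := ocap V1 V2.
have heV := frame_res he (@ocapl _ _ _ V1 V2); have heV' := frame_res he' (@ocapr _ _ _ V1 V2).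
have Vx : oset V x by [].
have [Z [ZV [Zx gen]]] := base_change_generates eps_nil bc heV heV' Vx.
pose Z1 := ocap Z W.
have [r sE] := gen Z1 (@ocapl _ _ _ Z W)
  (subset_trans (@ocapl _ _ _ Z W) ZV)
  (pres (@ocapr _ _ _ Z W) s).
have Z1x : oset Z1 x by [].
have lift i : exists T : {Z' : opens X & reg B Z'}, exists h : tag T `<=` Z1,
    oset (tag T) x /\ rmap f (tagged T) = rres h (r i).
  have [Z' [h [t tE]]] := reg_local_lift (r i) f_surj Z1x.
  by exists (existT _ Z' t), h.
have {}lift := fun i => cid (lift i).
pose T i := sval (lift i).
pose Z2 := ocap Z1 (obigcap (fun i => tag (T i))).
have Z2T i : Z2 `<=` tag (T i) by move=> y [_ /(_ i)].
have Z2Z1 : Z2 `<=` Z1 by exact: ocapl.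
have Z2V : Z2 `<=` V by move=> y [[/ZV]].
have Z2W : Z2 `<=` W by move=> y [[]].
exists Z2, Z2W, (lincomb (fun i => pres (@ocapl _ _ _ V1 V2) (e i)) Z2V
  (fun i => rres (Z2T i) (tagged (T i)))).
split; first by split=> // i; have [? []] := svalP (lift i).
rewrite smap_lincomb -(pres_comp (@ocapr _ _ _ Z W) Z2Z1) sE (lincomb_res _ _ _ Z2V).
congr lincomb; apply/funext => i; rewrite rmap_res.
have [h [_ ->]] := svalP (lift i).
by rewrite (rres_comp _ _ Z2Z1).
Qed.

End LocalLifting.
End BaseChange.

(** * Cech cocycles *)

Section FirstCohomology.
Variables (K : fieldType) (n : nat) (X : set (pspace K n)).
Variables (A : comAlgType K) (F : pmod X A).

Definition pair_index (x y : X) : 'I_2 -> X := fun i => if i == ord0 then x else y.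

(** A class vanishes in the colimit when it becomes a coboundary on a finer cover. Testing on any
    [Z] inside the overlaps spares later uses the dependent types of the intersections. *)
Lemma cocycle_splits (W : Defs.cover X) (c : cochain F W 1) :
  (forall a : cohom F 1, a = 0) -> cocycle c ->
  exists (U : Defs.cover X) (b : forall x, psec F (U x)), refines U W /\
    forall x y (Z : opens X) (hx : Z `<=` U x) (hy : Z `<=` U y)
      (h : Z `<=` meet W (pair_index x y)),
      pres h (c (pair_index x y) : psec F _) = pres hy (b y) - pres hx (b x).
Proof.
move=> H1 cc.
have /cclass_eq[U [hz [hw [b bE]]]] : cclass (Cocyc cc) = cclass (cocyc0 F 1) := H1 _.
have Ux x : U x `<=` meet U (fun _ : 'I_1 => x) by move=> y Uy i.
exists U, (fun x => pres (Ux x) (b (fun=> x) : psec F _)); split=> // x y Z hx hy h.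
have ZU : Z `<=` meet U (pair_index x y).
  by move=> z Zz i; rewrite /pair_index; case: ifP => _; [exact: hx|exact: hy].
(* A face of a pair is only provably equal to the constant map on ['I_1], so values of [b] at the
   two must be compared by transport. *)
have bsub (s s' : 'I_1 -> X) (k : Z `<=` meet U s) (k' : Z `<=` meet U s') :
    s = s' -> pres k (b s : psec F _) = pres k' (b s').
  by move=> ss'; move: k'; rewrite -ss' => k'; exact: pres_irr.
have := congr1 (fun s : psec F _ => pres ZU s) (bE (pair_index x y)).
rewrite /ccomb crefine0 // scaler0 add0r /crefine !kresE (pres_comp _ _ h) => ->.
rewrite /cdiff !big_ord_recl big_ord0 addr0 expr0 scale1r expr1 scaleN1r.
rewrite -[_ - _]/((_ : psec F _) - _) presB !kresE.
have k0 : Z `<=` meet U (pair_index x y \o lift ord0) by move=> z Zz i; exact: (ZU z Zz).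
have k1 : Z `<=` meet U (pair_index x y \o lift (lift ord0 ord0)).
  by move=> z Zz i; exact: (ZU z Zz).
have kx : Z `<=` meet U (fun _ : 'I_1 => x) by move=> z Zz i; exact: hx.
have ky : Z `<=` meet U (fun _ : 'I_1 => y) by move=> z Zz i; exact: hy.
rewrite (pres_comp _ _ k0) (pres_comp _ _ k1) (pres_comp _ _ kx) (pres_comp _ _ ky).
congr (_ - _); apply: bsub; apply/funext => i; rewrite /pair_index /=.
  by [].
by rewrite (ord1 i).
Qed.

End FirstCohomology.

(** * Contraction of ideal-valued sections with a functional *)

Section Contraction.
Variables (K : fieldType) (n : nat) (X : set (pspace K n)).
Variables (B : artAlg K) (E : pmod X (K^o : comAlgType K)) (D : pmod X B).
Implicit Types (V W Z : opens X) (x : X).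
Variables (pi : smor (aug B) D E) (l : {linear B -> K^o}).

(** On sections of J D this is the map to J D / m J D, which is J / m J tensored with [E], followed
    by the functional on the first factor. On other sections the formula may depend on the frame. *)
Definition contr V m (e : 'I_m -> psec D V) (he : is_frame e) W (h : W `<=` V)
    (t : psec D W) : psec E W :=
  lincomb (fun i => pi V (e i)) h (fun i => lmap l (fcoord he h t i)).

Section Frame.
Variables (V : opens X) (m : nat) (e : 'I_m -> psec D V) (he : is_frame e).

Lemma lmapD (W : opens X) (r r' : reg B W) : lmap l (r + r') = lmap l r + lmap l r'.
Proof. by apply: reval_ext => x _; rewrite revalD !reval_lmap revalD raddfD. Qed.

Lemma contrD W (h : W `<=` V) (s t : psec D W) :
  contr he h (s + t) = contr he h s + contr he h t.
Proof.
rewrite /contr /lincomb -big_split; apply: eq_bigr => i _ /=.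
by rewrite fcoordD lmapD scalerDl.
Qed.

Lemma contr0 W (h : W `<=` V) : contr he h 0 = 0.
Proof. by apply: (addIr (contr he h 0)); rewrite -contrD !add0r. Qed.

Lemma contrN W (h : W `<=` V) (t : psec D W) : contr he h (- t) = - contr he h t.
Proof. by apply: (addIr (contr he h t)); rewrite -contrD !addNr contr0. Qed.

Lemma contr_res W Z (h : W `<=` V) (hZ : Z `<=` W) (h' : Z `<=` V) (t : psec D W) :
  pres hZ (contr he h t) = contr he h' (pres hZ t).
Proof.
rewrite (lincomb_res _ _ _ h'); congr lincomb; apply/funext => i.
rewrite (fcoord_res he h hZ h').
by apply: reval_ext => x Zx; rewrite reval_res // !reval_lmap reval_res.
Qed.

(** This computes the effect of a correction: adding [a] times [t] to a section changes its
    contraction by exactly the reduction of [t]. *)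
Lemma contr_scale W (h : W `<=` V) (a : B) (t : psec D W) :
  (forall b, l (b * a) = aug B b) -> contr he h (regc W a *: t) = pi W t.
Proof.
move=> la; rewrite -[t in RHS](fcoordK he h) smap_lincomb.
congr lincomb; apply/funext => i; apply: reval_ext => x Wx.
by rewrite reval_lmap reval_rmap fcoordZ revalM reval_regc // mulrC la.
Qed.

End Frame.

Definition ideal_valued (J : set B) V m (e : 'I_m -> psec D V) (he : is_frame e)
    W (h : W `<=` V) (t : psec D W) : Prop :=
  forall i x, oset W x -> J (reval (fcoord he h t i) x).

(* The frame enters a J-valued section only modulo the maximal ideal. *)
Lemma contr_change_frame (J : set B) V m (e : 'I_m -> psec D V) (he : is_frame e)
    V' m' (e' : 'I_m' -> psec D V') (he' : is_frame e') W
    (h : W `<=` V) (h' : W `<=` V') (t : psec D W) :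
  (forall b j, J j -> l (b * j) = aug B b * l j) ->
  ideal_valued J he' h' t -> contr he h t = contr he' h' t.
Proof.
move=> lJ tJ; pose g j := fcoord he h (pres h' (e' j)).
have hW := @subset_refl _ W.
have gE j : pres h' (e' j) = lincomb e h (g j) by rewrite fcoordK.
have gE' j : pres h' (pi V' (e' j)) =
    lincomb (fun i => pi V (e i)) h (fun i => rmap (aug B) (g j i)).
  by rewrite -smap_res gE smap_lincomb.
have pull (A : comAlgType K) (F : pmod X A) (b : 'I_m' -> psec F V') r :
    lincomb b h' r = lincomb (fun j => pres h' (b j)) hW r.
  by apply: eq_bigr => j _; rewrite (pres_comp _ _ h').
rewrite /contr [RHS]pull (lincomb_comp hW h _ gE').
rewrite -[t in LHS](fcoordK he' h') [X in fcoord he h X]pull.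
rewrite (lincomb_comp hW h _ gE) lincombK; congr lincomb; apply/funext => i.
apply: reval_ext => x Wx; rewrite reval_lmap !reval_sum raddf_sum.
apply: eq_bigr => j _; rewrite !revalM !reval_res // reval_lmap reval_rmap.
rewrite (mulrC (reval (fcoord he' h' t j) x)).
exact: etrans (lJ _ _ (tJ _ _ Wx)) (mulrC _ _).
Qed.

End Contraction.

(** * Lifting global sections *)

Section GlobalLifting.
Variables (K : fieldType) (n : nat) (X : set (pspace K n)).
Variables (E : pmod X (K^o : comAlgType K)) (E_free : locally_free E).
Hypothesis H1_E : forall a : cohom E 1, a = 0.
Variables (B : artAlg K) (D : deformation E B).
Variables (A : comAlgType K) (f : {lrmorphism B -> A}) (F : pmod X A).
Variables (p : smor f D F) (s' : gsec F).
Implicit Types (V W Z : opens X) (x y : X).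

Variables (fv : X -> opens X) (fm : X -> nat).
Variables (fe : forall x, 'I_(fm x) -> psec D (fv x)).
Hypothesis hfe : forall x, is_frame (@fe x).

(** The property that descends along [J]. The cover is universally quantified because each
    correction refines it, while the frames stay fixed. The global lift [t] need not restrict to the
    given [s]. *)
Definition correctable (J : set B) : Prop :=
  forall (W : Defs.cover X) (hW : forall x, W x `<=` fv x)
    (s : forall x, psec D (W x)),
    (forall x, p (W x) (s x) = pres (@subT _ _ _ _) s') ->
    (forall x y Z (hx : Z `<=` W x) (hy : Z `<=` W y),
      ideal_valued J (@hfe x) (subset_trans hx (hW x))
        (pres hx (s x) - pres hy (s y))) ->
  exists t : gsec D, p _ t = s'.

(** The local lifts agree and glue in [D]; uniqueness of gluing in [F] identifies the image with
    [s']. *)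
Lemma correctable_zero (J : set B) : is_sheaf F -> (forall j, J j -> j = 0) ->
  correctable J.
Proof.
move=> Fsh J0 W hW s sE sJ.
have [||t [tE _]] := @dsheafP _ _ _ _ _ D (oall X) X W (fun x => @subT _ _ _ (W x)) _ s.
- by move=> x _; exists x; exact: covP.
- move=> x y hx hy; apply/eqP; rewrite -subr_eq0; apply/eqP.
  rewrite -[LHS](fcoordK (@hfe x) (subset_trans hx (hW x))).
  rewrite /lincomb big1 // => i _.
  rewrite [fcoord _ _ _ _](_ : _ = 0) ?scale0r //.
  by apply: reval_ext => z Zz; rewrite reval0; apply: J0; apply: sJ.
exists t; have [||u [_ uuniq]] := Fsh (oall X) X W (fun x => @subT _ _ _ (W x)) _
    (fun x => p (W x) (s x)).
- by move=> x _; exists x; exact: covP.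
- by move=> x y hx hy; rewrite !sE !(pres_comp _ _ (@subT _ _ _ _)).
transitivity u; [apply/esym|]; apply: uuniq => x; last by rewrite sE.
by rewrite -smap_res tE.
Qed.

Section Step.
Variables (J : set B) (l : {linear B -> K^o}) (a : B).
Hypotheses (Jid : is_ideal J) (Jf : forall j, J j -> f j = 0).
Hypotheses (Ja : J a) (la : l a = 1).
Hypothesis lJ : forall b j, J j -> l (b * j) = aug B b * l j.

Let J' : set B := [set j | J j /\ l j = 0].

Section Cocycle.
Variables (W : Defs.cover X) (hW : forall x, W x `<=` fv x).
Variable s : forall x, psec D (W x).
Hypothesis sJ : forall x y Z (hx : Z `<=` W x) (hy : Z `<=` W y),
  ideal_valued J (@hfe x) (subset_trans hx (@hW x)) (pres hx (@s x) - pres hy (@s y)).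

Definition transition x y Z (hx : Z `<=` W x) (hy : Z `<=` W y) : ksec E Z :=
  contr (dpi D) l (@hfe x) (subset_trans hx (@hW x)) (pres hx (@s x) - pres hy (@s y)).

Lemma transition_res x y Z Z' (hx : Z `<=` W x) (hy : Z `<=` W y) (h : Z' `<=` Z)
    (hx' : Z' `<=` W x) (hy' : Z' `<=` W y) :
  kres h (transition hx hy) = transition hx' hy'.
Proof.
rewrite kresE (contr_res _ _ _ _ _ (subset_trans hx' (@hW x))).
by rewrite presB (pres_comp _ _ hx') (pres_comp _ _ hy').
Qed.

Lemma transition_eq x y x' y' Z (hx : Z `<=` W x) (hy : Z `<=` W y)
    (hx' : Z `<=` W x') (hy' : Z `<=` W y') :
  x = x' -> y = y' -> transition hx hy = transition hx' hy'.
Proof.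
move=> xx' yy'; move: hx' hy'; rewrite -xx' -yy' => hx' hy'.
by rewrite (Prop_irrelevance hx hx') (Prop_irrelevance hy hy').
Qed.

(** The three terms are contracted in the frames at [x] and [y]. The differences being [J]-valued,
    all may be contracted in the frame at [x], where additivity makes the sum telescope. *)
Lemma transition_cocycle x y z Z (hx : Z `<=` W x) (hy : Z `<=` W y) (hz : Z `<=` W z) :
  transition hy hz - transition hx hz + transition hx hy = 0.
Proof.
have yz : transition hy hz = contr (dpi D) l (@hfe x) (subset_trans hx (@hW x))
    (pres hy (@s y) - pres hz (@s z)).
  by rewrite /transition; apply/esym; apply: contr_change_frame lJ _; exact: sJ.
rewrite yz /transition -[LHS]/((_ - _ : psec E Z) + _) -contrN -!contrD.
set sx := pres hx _; set sy := pres hy _; set sz := pres hz _.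
rewrite (_ : sy - sz - (sx - sz) + (sx - sy) = 0); first exact: contr0.
by rewrite opprB (addrA (sy - sz)) subrK -[sx - sy]opprB subrr.
Qed.

Lemma meet_sub p' (t : 'I_p' -> X) i : meet W t `<=` W (t i).
Proof. by move=> x Wx; exact: Wx. Qed.

Lemma transition_coboundary : exists (U : Defs.cover X) (b : forall x, psec E (U x)),
  refines U W /\ forall x y Z (hx : Z `<=` U x) (hy : Z `<=` U y)
    (hx' : Z `<=` W x) (hy' : Z `<=` W y),
    transition hx' hy' = pres hy (b y) - pres hx (b x).
Proof.
pose i1 : 'I_2 := lift ord0 ord0.
pose c : cochain E W 1 := fun t => transition (@meet_sub _ t ord0) (@meet_sub _ t i1).
have cc : cocycle c.
  move=> t; have mt i : meet W t `<=` W (t i) by exact: meet_sub.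
  pose k1 : 'I_3 := lift ord0 ord0; pose k2 : 'I_3 := lift ord0 i1.
  have face (j : 'I_3) i i' : i = lift j ord0 -> i' = lift j i1 ->
      kres (@meet_face _ _ _ W _ _ t (lift j)) (c (t \o lift j)) = transition (mt i) (mt i').
    move=> iE i'E.
    have hi : meet W t `<=` W ((t \o lift j) ord0) by rewrite /= -iE.
    have hi' : meet W t `<=` W ((t \o lift j) i1) by rewrite /= -i'E.
    rewrite /c (transition_res _ _ _ hi hi').
    by apply: transition_eq; rewrite /= -?iE -?i'E.
  rewrite /cdiff !big_ord_recl big_ord0 addr0 expr0 scale1r expr1 scaleN1r.
  rewrite (_ : (-1) ^+ _ = 1) ?scale1r; last by rewrite /= sqrrN expr1n.
  rewrite (face ord0 k1 k2) // (face k1 ord0 k2); try exact: val_inj.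
  rewrite (face k2 ord0 k1); try exact: val_inj.
  by rewrite addrA; exact: transition_cocycle.
have [U [b [UW bE]]] := cocycle_splits H1_E cc.
exists U, b; split=> // x y Z hx hy hx' hy'.
have h : Z `<=` meet W (pair_index x y).
  by move=> z Zz i; rewrite /pair_index; case: ifP => _; [exact: hx'|exact: hy'].
rewrite -(bE x y Z hx hy h); symmetry; exact: transition_res.
Qed.

End Cocycle.

(** Sections [b x] splitting the transition cocycle lift locally along the reduction to sections
    [t x], and [s x] becomes [s x + a t x]. As [f a = 0], its image in [F] is unchanged. On overlaps
    the contraction becomes (b y - b x) + (b x - b y) = 0. *)
Lemma correctable_step : correctable J' -> correctable J.
Proof.
move=> cJ' W hW s sE sJ.
have [U [b [UW bE]]] := transition_coboundary sJ.
have eps_nil (c : K^o) : (idfun : {lrmorphism K^o -> (K^o : comAlgType K)}) c = 0 ->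
  exists N, c ^+ N = 0 by move=> c0; exists 1%N; rewrite expr1.
have aug_surj (c : (K^o : comAlgType K)) : exists d, aug B d = c.
  by exists (c : K)%:A; exact: aug_alg.
have lift x : exists T : {Z : opens X & psec D Z}, exists h : tag T `<=` U x,
    oset (tag T) x /\ dpi D _ (tagged T) = pres h (b x).
  have [Z [h [t tE]]] := base_change_local_lift aug_surj eps_nil (@dpiP _ _ _ _ _ D)
    (@dlocfree _ _ _ _ _ D) E_free (b x) (covP U x).
  by exists (existT _ Z t), h.
have {}lift := fun x => cid (lift x).
pose T x := sval (lift x).
have TU x : tag (T x) `<=` U x by have [] := svalP (lift x).
have Tx x : oset (tag (T x)) x by have [? []] := svalP (lift x).
have Tb x : dpi D _ (tagged (T x)) = pres (TU x) (b x).
  by have [h [_ ->]] := svalP (lift x); exact: pres_irr.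
pose W' := Cover Tx.
have W'W x : W' x `<=` W x by apply: subset_trans (TU x) (UW x).
have hW' x : W' x `<=` fv x by apply: subset_trans (W'W x) (hW x).
pose t x : psec D (W' x) := tagged (T x).
pose s1 x : psec D (W' x) := pres (W'W x) (s x) + regc _ a *: t x.
apply: (cJ' W' hW' s1) => [x|x y Z hx hy].
  rewrite smapD smapZ smap_res sE (pres_comp _ _ (@subT _ _ _ _)).
  rewrite (_ : rmap f _ = 0) ?scale0r ?addr0 //.
  by apply: reval_ext => z Wz; rewrite reval_rmap reval_regc // reval0 Jf.
pose hxW := subset_trans hx (W'W x); pose hyW := subset_trans hy (W'W y).
have dE : pres hx (s1 x) - pres hy (s1 y) =
    (pres hxW (s x) - pres hyW (s y)) + regc Z a *: (pres hx (t x) - pres hy (t y)).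
  rewrite !pres_add !pres_scale !rres_regc (pres_comp _ _ hxW) (pres_comp _ _ hyW).
  by rewrite scalerBr opprD addrACA.
set h := subset_trans hx (hW' x).
have hh : subset_trans hxW (hW x) = h by exact: Prop_irrelevance.
have laug c : l (c * a) = aug B c by rewrite lJ // la mulr1.
have sJZ := sJ x y Z hxW hyW; rewrite hh in sJZ.
have contr_d : contr (dpi D) l (@hfe x) h (pres hx (s1 x) - pres hy (s1 y)) = 0.
  rewrite dE contrD contr_scale // smapB !smap_res !Tb.
  pose kx := subset_trans hx (TU x); pose ky := subset_trans hy (TU y).
  have := bE x y Z kx ky hxW hyW; rewrite /transition hh => ->.
  rewrite (pres_comp _ _ kx) (pres_comp _ _ ky).
  by rewrite addrA subrK subrr.
(* The reduced frame is independent, so a zero contraction means that every coordinate of the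
   difference lies in the kernel of [l]. *)
have d0 := base_change_independent (@dpiP _ _ _ _ _ D) (@hfe x) contr_d.
move=> i z Zz; split; last first.
  by rewrite -reval_lmap (d0 i) reval0.
rewrite dE fcoordD fcoordZ revalD revalM reval_regc //.
have [_ JD JM] := Jid; apply: JD; first exact: sJZ.
by rewrite mulrC; apply: JM.
Qed.

End Step.

Lemma correctable_kernel (I : set B) : is_sheaf F -> is_ideal I ->
  (forall j, I j -> f j = 0) -> correctable I.
Proof.
move=> Fsh Iid If; apply: contrapT => nI.
pose Q (J : set B) := [/\ is_ideal J, forall j, J j -> f j = 0 & ~ correctable J].
have [||J [Jid Jf nJ] Jmin] := @artinian_minimal _ B Q (@art_artinian _ B).
- by move=> J [].
- by exists I.
have [j Jj j0] : exists2 j, J j & j != 0.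
  apply: contrapT => J0; apply: nJ; apply: correctable_zero => // j Jj.
  by apply/eqP; apply: contrapT => /negP j0; apply: J0; exists j.
have [l [a [Ja la lJ]]] := ideal_functional Jid (ex_intro2 _ _ j Jj j0).
apply: nJ; apply: (correctable_step Jid Jf Ja la lJ); apply: contrapT => nJ'.
have [J0 JD JM] := Jid.
(* The kernel of [l] in [J] is an ideal because [l] is semilinear over the residue map on [J].
   Minimality would make it all of [J], against [l a = 1]. *)
have J'J : [set j | J j /\ l j = 0] = J.
  apply: Jmin; last by move=> ? [].
  split=> //; last by move=> ? [/Jf].
  split=> [|x y [Jx lx] [Jy ly]|b x [Jx lx]]; split.
  - by [].
  - exact: raddf0.
  - exact: JD.
  - by rewrite raddfD /= lx ly addr0.
  - exact: JM.
  - by rewrite lJ // lx mulr0.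
have : J a by []; rewrite -J'J => -[_ /eqP]; rewrite la.
by rewrite oner_eq0.
Qed.

End GlobalLifting.

(** [A] is only asked to have an augmentation with nilpotent kernel, so that the result covers both
    base changes between Artinian algebras and the reduction to [E], where [A] is [K] itself. *)
Theorem base_change_global_lift (K : fieldType) (n : nat) (X : set (pspace K n))
    (E : pmod X (K^o : comAlgType K)) (B : artAlg K) (D : deformation E B)
    (A : comAlgType K) (eps : {lrmorphism A -> (K^o : comAlgType K)})
    (f : {lrmorphism B -> A}) (F : pmod X A) (p : smor f D F) :
  locally_free E -> (forall a : cohom E 1, a = 0) ->
  (forall a, eps a = 0 -> exists N, a ^+ N = 0) -> (forall a, exists b, f b = a) ->
  is_sheaf F -> locally_free F -> is_base_change p ->
  forall s' : gsec F, exists t : gsec D, p _ t = s'.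
Proof.
move=> E_free H1_E eps_nil f_surj Fsh F_free bc s'.
have fr x := cid (@dlocfree _ _ _ _ _ D x).
pose fv x := sval (fr x).
have fr2 x := cid (svalP (fr x)).
pose fm x := sval (fr2 x).
have fr3 x := cid (svalP (fr2 x)).
pose fe x : 'I_(fm x) -> psec D (fv x) := sval (fr3 x).
have fvx x : oset (fv x) x := (svalP (fr3 x)).1.
have hfe x : is_frame (fe x) := (svalP (fr3 x)).2.
have lift x : exists T : {Z : opens X & psec D Z}, exists h : tag T `<=` fv x,
    oset (tag T) x /\ p _ (tagged T) = pres (@subT _ _ _ _) s'.
  have [Z [h [t [Zx tE]]]] := base_change_local_lift f_surj eps_nil bc
    (@dlocfree _ _ _ _ _ D) F_free (pres (@subT _ _ _ (fv x)) s') (fvx x).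
  exists (existT _ Z t), h; split=> //.
  by rewrite tE (pres_comp _ _ (@subT _ _ _ _)).
have {}lift := fun x => cid (lift x).
pose T x := sval (lift x).
have Tv x : tag (T x) `<=` fv x by have [] := svalP (lift x).
have Tx x : oset (tag (T x)) x by have [? []] := svalP (lift x).
have TE x : p _ (tagged (T x)) = pres (@subT _ _ _ _) s'.
  by have [? []] := svalP (lift x).
have kid : is_ideal [set b | f b = 0].
  split=> [|x y /= xe ye|b x /= xe]; first exact: rmorph0.
    by rewrite rmorphD; exact: etrans (congr2 +%R xe ye) (addr0 _).
  by rewrite rmorphM; exact: etrans (congr1 _ xe) (mulr0 _).
have := @correctable_kernel _ _ _ _ E_free H1_E _ _ _ _ _ p s' _ _ _ hfe _ Fsh kid.
move=> /(_ (fun _ b0 => b0) (Cover Tx) Tv (fun x => tagged (T x)) TE); apply.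
move=> x y Z hx hy i z Zz /=.
(* Two local lifts of [s'] differ by a section killed by [p]; independence of the images of the
   frame puts its coordinates in the kernel of [f]. *)
set t := _ - _; have pt : p Z t = 0.
  rewrite smapB !smap_res !TE (pres_comp _ _ (@subT _ _ _ _)).
  by rewrite (pres_comp _ _ (@subT _ _ _ _)) subrr.
set h := subset_trans _ _.
rewrite -reval_rmap (base_change_independent bc (hfe x)
  (r := fun i => rmap f (fcoord (hfe x) h t i))) ?reval0 //.
by rewrite -smap_lincomb fcoordK.
Qed.

(** * Smoothness of the functors *)

Lemma iso_class_eq (K : fieldType) (M : moduli K) (A : artAlg K)
  (c c' : iso_class M A) : cset c = cset c' -> c = c'.
Proof.
case: c c' => [s sP] [s' s'P] /= ss'; rewrite -ss' in s'P *.
by rewrite (Prop_irrelevance sP s'P).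
Qed.

Section FirstCohomologyVanishes.
Variables (K : fieldType) (n : nat) (X : set (pspace K n)).
Variables (E : pmod X (K^o : comAlgType K)) (k : nat) (U : Gr (H0 E) k).

(** The argument of type ['I_k] encodes k > 0. Multiplying [a] by the [j]-th coordinate is a linear
    map on [U] whose value at the [j]-th basis vector is [a]. *)
Lemma hom_H1_zero_vanishing : hom_H1_zero U -> 'I_k -> forall a : cohom E 1, a = 0.
Proof.
move=> HU j a; have [indep UE] := gbasisP U.
have span (u : gsub U) : exists c : 'I_k -> K, gval u = \sum_i c i *: gbasis U i.
  by have := valP u; rewrite -topredE /= /gpred UE => /set_mem.
pose co u := sval (cid (span u)).
have coE u : gval u = \sum_i co u i *: gbasis U i := svalP (cid (span u)).
have co_uniq u c i : gval u = \sum_i c i *: gbasis U i -> co u i = c i.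
  rewrite coE => /eqP; rewrite -subr_eq0 -sumrB => /eqP cc.
  apply/eqP; rewrite -subr_eq0; apply/eqP; apply: (indep (fun i => co u i - c i)).
  by rewrite -[RHS]cc; apply: eq_bigr => l _; rewrite scalerBl.
pose f u : cohom E 1 := co u j *: a.
have f_lin : linear f.
  move=> c u v; rewrite /f (co_uniq _ (fun i => c * co u i + co v i)).
    by rewrite scalerDl scalerA.
  rewrite [gval (c *: u + v)](_ : _ = c *: gval u + gval v) // {1}coE {1}(coE v).
  rewrite scaler_sumr -big_split; apply: eq_bigr => i _ /=.
  by rewrite scalerDl scalerA.
pose fM := GRing.isLinear.Build K (gsub U) (cohom E 1) *:%R f f_lin.
pose F : {linear gsub U -> cohom E 1} := HB.pack f fM.
have bE : gbasis U j = \sum_i (j == i)%:R *: gbasis U i.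
  rewrite (bigD1 j) //= eqxx scale1r big1 ?addr0 // => i /negPf ij.
  by rewrite eq_sym ij scale0r.
have bU : gbasis U j \in gpred U.
  rewrite -topredE /= /gpred UE; apply/mem_set.
  by exists (fun i => (j == i)%:R).
have := HU F (GSub bU); rewrite -[F _]/(co _ j *: a).
by rewrite (co_uniq _ (fun i => (j == i)%:R)) // eqxx scale1r.
Qed.

End FirstCohomologyVanishes.

Section Smoothness.
Variables (K : fieldType) (n : nat) (X : set (pspace K n)).
Variables (E : pmod X (K^o : comAlgType K)).
Hypotheses (E_sheaf : is_sheaf E) (E_free : locally_free E).
Variables (k : nat) (U : Gr (H0 E) k).
Hypothesis H1_E : 'I_k -> forall a : cohom E 1, a = 0.

(** Lifting a family indexed by ['I_k] supplies the index that [H1_E] asks for, and makes the case k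
    = 0 vacuous. *)
Lemma lift_along_reduction (A : artAlg K) (D : deformation E A) (s : 'I_k -> gsec E) :
  exists t : 'I_k -> gsec D, forall j, dpi D _ (t j) = s j.
Proof.
suff /choice[t tE] : forall j, exists t : gsec D, dpi D _ t = s j by exists t.
move=> j; apply: (base_change_global_lift (eps := idfun) (p := dpi D)) => //.
- exact: H1_E.
- by move=> a a0; exists 1%N; rewrite expr1.
- by move=> c; exists (c : K)%:A; exact: aug_alg.
- exact: dpiP.
Qed.

Lemma lift_along_base_change (B A : artAlg K) (f : {lrmorphism B -> A})
    (D : deformation E B) (D' : deformation E A) (p : smor f D D')
    (s : 'I_k -> gsec D') :
  (forall a, exists b, f b = a) -> is_base_change p ->
  exists t : 'I_k -> gsec D, forall j, p _ (t j) = s j.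
Proof.
move=> f_surj bc.
suff /choice[t tE] : forall j, exists t : gsec D, p _ t = s j by exists t.
move=> j; apply: (base_change_global_lift (eps := aug A)) bc _ => //.
- exact: H1_E.
- exact: aug_nilpotent.
- exact: dsheafP.
- exact: dlocfree.
Qed.

Section PairOfSections.
Variables (A : artAlg K) (D : deformation E A) (t : 'I_k -> gsec D).
Hypothesis tE : forall j, dpi D (oall X) (t j) = gbasis U j.

Definition tens_sections (u : 'rV[A]_k) : gsec D := \sum_j regc _ (u 0 j) *: t j.

Lemma tens_sections_linear (a : A) u v :
  tens_sections (a *: u + v) = regc _ a *: tens_sections u + tens_sections v.
Proof.
rewrite /tens_sections scaler_sumr -big_split; apply: eq_bigr => j _ /=.
by rewrite !mxE rmorphD rmorphM scalerDl scalerA.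
Qed.

Lemma tens_sections_red u : dpi D (oall X) (tens_sections u) = tens_red U u.
Proof.
rewrite smap_sum /tens_red.
elim: (index_enum _) => [|j l IH]; first by rewrite !big_nil.
rewrite !big_cons IH smapZ tE; congr (_ + _).
rewrite -[RHS]/(regc _ _ *: (gbasis U j : psec E _)); congr (_ *: _).
by apply: reval_ext => x _; rewrite reval_rmap !reval_regc //; exact: esym (mulr1 _).
Qed.

Definition pair_of_sections : pair_deformation U A :=
  PairDeformation tens_sections_linear tens_sections_red.

End PairOfSections.

Lemma pdi_basis (A : artAlg K) (P : pair_deformation U A) u :
  pdi P u = \sum_j regc _ (u 0 j) *: pdi P (delta_mx 0 j).
Proof.
have pdi0 : pdi P 0 = 0.
  apply: (addIr (pdi P 0)); rewrite add0r.
  by rewrite -[X in X + _]scale1r -(rmorph1 (@regc _ _ _ A _)) -pdi_linear scale1r addr0.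
rewrite {1}(row_sum_delta u); elim: (index_enum _) => [|j l IH].
  by rewrite !big_nil.
by rewrite !big_cons pdi_linear IH.
Qed.

Lemma smooth_pairs : smooth (Def_E E) -> smooth (Def_EU U).
Proof.
move=> sE B A f f_surj c; have [P0 cE] := csetP c.
have [x [DB [D' [xDB]]]] := sE B A f f_surj (iso_class_of (M := moduli_E E) (pdef P0)).
move=> [phi [phi_iso phiE]] [p [bc pE]].
have lin (a : A) u v : phi _ (pdi P0 (a *: u + v)) =
    regc _ a *: phi _ (pdi P0 u) + phi _ (pdi P0 v).
  by rewrite pdi_linear smap_linear rmap_id.
have red u : dpi D' (oall X) (phi _ (pdi P0 u)) = tens_red U u.
  by rewrite phiE pdi_red.
(* The lifted sheaf restricts to [D'], which is only isomorphic to the sheaf of [P0]; the sections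
   are transported along [phi] before being lifted. *)
pose P' := PairDeformation lin red.
have [t tE] := lift_along_base_change (fun j => pdi P' (delta_mx 0 j)) f_surj bc.
(* Reduction from [DB] factors through [p], so a lift of the [j]-th section of [P'] still reduces to
   the [j]-th basis vector. *)
have tE' j : dpi DB (oall X) (t j) = gbasis U j.
  rewrite -pE tE [LHS]pdi_red /tens_red (bigD1 j) //= mxE !eqxx aug1 scale1r.
  rewrite big1 ?addr0 // => i /negPf ij; rewrite mxE eqxx ij /= aug0.
  exact: scale0r.
exists (iso_class_of (M := moduli_EU U) (pair_of_sections tE')).
exists (pair_of_sections tE'), P'; split; first exact: pair_iso_refl.
  by rewrite cE; exists phi, idfun; split=> //; exists id.
exists p; split=> // u; rewrite smap_sum [RHS]pdi_basis.
apply: eq_bigr => j _; rewrite smapZ tE mxE; congr (_ *: _).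
by apply: reval_ext => y _; rewrite reval_rmap !reval_regc.
Qed.

(** A basis of [U] lifts along the reduction and enriches the given sheaf to a pair; the pair is
    lifted by smoothness and its sections are forgotten. *)
Lemma smooth_sheaf : smooth (Def_EU U) -> smooth (Def_E E).
Proof.
move=> sEU B A f f_surj y; have [D yE] := csetP y.
have [t tE] := lift_along_reduction D (fun j => gbasis U j).
have [x [P [P' [_ PP' [p [bc _]]]]]] :=
  sEU B A f f_surj (iso_class_of (M := moduli_EU U) (pair_of_sections tE)).
exists (iso_class_of (M := moduli_E E) (pdef P)), (pdef P), (pdef P').
split; first exact: def_iso_refl; last by exists p.
by rewrite yE; have [phi [psi [phiP _ _]]] := PP'; exists phi.
Qed.

Lemma r_U_surjective (A : artAlg K) (y : fob (Def_E E) A) :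
  exists c : fob (Def_EU U) A, r_U c = y.
Proof.
have [D yE] := csetP y.
have [t tE] := lift_along_reduction D (fun j => gbasis U j).
exists (iso_class_of (M := moduli_EU U) (pair_of_sections tE)).
apply: iso_class_eq; rewrite yE; apply/funext => D'; apply/propext; split.
  by move=> [P [phi [psi [phiP _ _]]]]; apply: def_iso_trans; exists phi.
by move=> DD'; exists (pair_of_sections tE) => //; exact: pair_iso_refl.
Qed.

(** Surjectivity of [r_U] for the single subspace [U] makes the condition cutting out the subfunctor
    hold for every class. *)
Lemma smooth_Def_k : smooth (Def_E E) <-> smooth (Def_k E k).
Proof.
have all_k (A : artAlg K) (y : fob (Def_E E) A) :
    exists (V : Gr (H0 E) k) (c : fob (Def_EU V) A), r_U c = y.
  by exists U; exact: r_U_surjective.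
split=> sE B A f f_surj y.
  have [x xy] := sE B A f f_surj (sval y).
  by exists (exist _ x (all_k B x)).
by have [x xy] := sE B A f f_surj (exist _ y (all_k A y)); exists (sval x).
Qed.

End Smoothness.

Theorem proposition4p4 (K : closedFieldType) (char0 : [pchar K] =i pred0)
    (n : nat) (X : set (pspace K n)) (X_variety : smooth_projective_variety X)
    (H1_OX : forall a : cohom (struct_pmod X K^o) 1, a = 0)
    (H2_OX : forall a : cohom (struct_pmod X K^o) 2, a = 0)
    (E : pmod X K^o) (E_sheaf : is_sheaf E) (E_locfree : locally_free E)
    (k : nat) (h0_E : h0_ge E k)
    (U : Gr (H0 E) k) (Hom_U : hom_H1_zero U) :
  alpha_surjective U /\
  (smooth (Def_E E) <-> smooth (Def_EU U)) /\
  (smooth (Def_EU U) <-> smooth (Def_k E k)).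
Proof.
have H1_E := hom_H1_zero_vanishing Hom_U.
have sheaf_pair : smooth (Def_E E) <-> smooth (Def_EU U).
  by split; [exact: smooth_pairs|exact: smooth_sheaf].
split; last first.
  split=> //; apply: iff_trans (iff_sym sheaf_pair) _.
  exact: (smooth_Def_k E_sheaf E_locfree U H1_E).
(* [f] and the map attached to 0 both lie in a zero space. *)
by move=> f; exists 0 => u; rewrite Hom_U; exact: Hom_U.
Qed.
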